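(* Let $\mathbb{T}$ be an unbounded above time scale that is periodic in shifts $\delta_\pm$ (associated with an initial point $t_0\in\mathbb{T}^*$) with period $P\in(t_0,+\infty)_{\mathbb{T}^*}$, let $T\in[P,+\infty)_{\mathbb{T}^*}$, let $D'\subset D\subset\mathbb{R}^n$, $x_0\in D'$, $Q=\{(t,x): t\in\mathbb{T},\ x\in D\}$, and let $X:Q\to\mathbb{R}^n$. Write $\delta^{(i)}(t_0)$ for the $i$-fold composition of $\delta_+(T,\cdot)$ applied to $t_0$ (with $\delta^{(0)}(t_0)=t_0$). For a small parameter $\varepsilon>0$ let $x(t)$ denote the solution of $$x^{\Delta}=\varepsilon X(t,x),\qquad x(t_0)=x_0,$$ and let $\xi(t)$ denote the solution of the partially averaged system $$\xi^{\Delta}=\varepsilon\widetilde X(t,\xi),\qquad \xi(t_0)=x_0,$$ where $$\widetilde X(t,x)=\widetilde X_i(x)=\frac{1}{\delta^{(i+1)}(t_0)-\delta^{(i)}(t_0)}\int_{\delta^{(i)}(t_0)}^{\delta^{(i+1)}(t_0)}X(s,x)\,\Delta s\quad\text{for }\delta^{(i)}(t_0)\le t<\delta^{(i+1)}(t_0),\ i=0,1,2,\dots$$ Suppose the following conditions hold in $Q$: 1) every component of $X(t,x)$ is, for each fixed $x$, a $\Delta$-periodic in shifts $\delta_\pm(T,t)$ function of $t$; 2) $X(t,x)$ is rd-continuous with respect to $t$ and regressive; $X$ satisfies conditions of existence and uniqueness of the solution of the Cauchy problem; there is $M>0$ with $\|X(t,x)\|\le M$ for all $(t,x)\in Q$;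 and there is $\lambda>0$ with $\|X(t,x_1)-X(t,x_2)\|\le\lambda\|x_1-x_2\|$ for all $(t,x_1),(t,x_2)\in Q$; 3) there exists a constant $K>0$ such that $\delta^{(i+1)}(t_0)-\delta^{(i)}(t_0)\le K$ for all $i\ge1$; 4) there are $\bar\varepsilon>0$ and $\rho>0$ such that, for every $\varepsilon\in(0,\bar\varepsilon]$, the solution $\xi(t)$ of the averaged system with $\xi(t_0)=x_0\in D'$ is well defined for all $t\in\mathbb{T}^\kappa$ and lies in $D$ together with its $\rho$-neighbourhood. Then for any $L>0$ there exist $\varepsilon_0=\varepsilon_0(L)>0$ and a constant $C>0$ (independent of $\varepsilon$ and $t$) such that for all $0<\varepsilon<\varepsilon_0$ and all $t\in[t_0,t_0+L\varepsilon^{-1}]\cap\mathbb{T}$ $$\|x(t)-\xi(t)\|\le C\varepsilon.$$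
   Context: A time scale $\mathbb{T}$ is a nonempty closed subset of $\mathbb{R}$. Standard time scale calculus is used: forward jump $\sigma(t)=\inf\{s\in\mathbb{T}:s>t\}$, graininess $\mu(t)=\sigma(t)-t$, $\mathbb{T}^\kappa=\mathbb{T}$ with its maximum removed if that maximum exists and is left-scattered, and $\mathbb{T}^\kappa=\mathbb{T}$ otherwise; $f^\Delta$ is the $\Delta$-derivative ($|f(\sigma(t))-f(s)-f^\Delta(t)(\sigma(t)-s)|\le\epsilon|\sigma(t)-s|$ for $s$ in a neighbourhood of $t$ in $\mathbb{T}$ depending on $\epsilon>0$), and $\int\cdot\,\Delta s$ the $\Delta$-integral. A function is rd-continuous if it is continuous at right-dense points and has finite left limits at left-dense points. $X$ is regressive if for every $t\in\mathbb{T}^\kappa$ the map $x\mapsto x+\mu(t)X(t,x)$ is invertible. For a set $S\subset\mathbb{R}$, $[a,b)_S=[a,b)\cap S$, and similarly for other intervals. Shift operators. Let $\mathbb{T}^*\subset\mathbb{T}$ be a nonempty subset containing a fixed point $t_0$. The shift operators $\delta_\pm:[t_0,\infty)_{\mathbb{T}}\times\mathbb{T}^*\to\mathbb{T}^*$ (partially defined), with domains $D_\pm=\{(s,t)\in[t_0,\infty)_{\mathbb{T}}\times\mathbb{T}^*:\delta_\pm(s,t)\in\mathbb{T}^*\}$, satisfy: (P1) each $\delta_\pm(s,\cdot)$ is strictly increasing on its domain; (P2) $\delta_+(\cdot,u)$ is strictly increasing and $\delta_-(\cdot,u)$ is strictly decreasing; (P3) for $t\in[t_0,\infty)_{\mathbb{T}}$,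 $(t,t_0)\in D_+$ and $\delta_+(t,t_0)=t$; for $t\in\mathbb{T}^*$, $(t_0,t)\in D_+$ and $\delta_+(t_0,t)=t$; (P4) if $(s,t)\in D_\pm$, then $(s,\delta_\pm(s,t))\in D_\mp$ and $\delta_\mp(s,\delta_\pm(s,t))=t$; (P5) if $(s,t)\in D_\pm$ and $(u,\delta_\pm(s,t))\in D_\mp$, then $(s,\delta_\mp(u,t))\in D_\pm$ and $\delta_\mp(u,\delta_\pm(s,t))=\delta_\pm(s,\delta_\mp(u,t))$. $\mathbb{T}$ is periodic in shifts $\delta_\pm$ if there is $p\in(t_0,\infty)_{\mathbb{T}^*}$ with $(p,t)\in D_\mp$ (i.e. in both $D_-$ and $D_+$) for all $t\in\mathbb{T}^*$; if the infimum $P$ of all such $p$ is different from $t_0$, then $P$ is called the period of $\mathbb{T}$. A function $f$ on $\mathbb{T}^*$ is $\Delta$-periodic in shifts $\delta_\pm(T,t)$, $T\in[P,\infty)_{\mathbb{T}^*}$, if $(T,t)\in D_\pm$ for all $t\in\mathbb{T}^*$, the shifts $\delta_\pm(T,t)$ are $\Delta$-differentiable in $t$ with rd-continuous derivative $\delta_\pm^\Delta(T,t)$, and $f(\delta_\pm(T,t))\,\delta_\pm^\Delta(T,t)=f(t)$ for all $t\in\mathbb{T}^*$ (for both signs). *)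

(* Defs.v *)
(* R^n is 'rV[R]_n with the sup norm; constants are existentially quantified or
   arbitrary, so passing to an equivalent norm is immaterial. *)
From HB Require Import structures.
From mathcomp Require Import all_boot all_order all_algebra.
From mathcomp Require Import all_classical all_reals all_analysis.

Set Implicit Arguments.
Unset Strict Implicit.
Unset Printing Implicit Defensive.

Import Order.TTheory GRing.Theory Num.Theory.
Import numFieldNormedType.Exports.
Local Open Scope classical_set_scope.
Local Open Scope ring_scope.

Section TimeScale.
Context {R : realType}.
Implicit Types (T E D I : set R) (t : R).

Definition time_scale T := T !=set0 /\ closed T.

Definition unbounded_above T := forall a : R, exists2 t, T t & a < t.

(* The conventions inf set0 = sup T and sup set0 = inf T make a maximum
   (minimum) of T a fixed point of the forward (backward) jump. *)
Definition sigma T t : R :=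
  if `[< exists2 s, T s & t < s >] then inf [set s | T s /\ t < s] else t.

Definition rho T t : R :=
  if `[< exists2 s, T s & s < t >] then sup [set s | T s /\ s < t] else t.

Definition mu T t : R := sigma T t - t.

Definition right_dense T t := (exists2 s, T s & t < s) /\ sigma T t = t.

Definition left_dense T t := (exists2 s, T s & s < t) /\ rho T t = t.

Definition left_scattered T t := rho T t < t.

Definition kappa T : set R :=
  [set t | T t /\ ~ ((forall s, T s -> s <= t) /\ left_scattered T t)].

(* [d] is the delta derivative at [t] of the function [f], whose domain is the
   subset [E] of the time scale [T]: the jump is that of [T], and the points [s]
   near [t] range over [E].  [E = T] is the usual delta derivative. *)
Definition is_delta_derive (V : normedModType R) T E (f : R -> V) t (d : V) :=
  forall e : R, 0 < e -> \forall s \near t, E s ->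
    `|f (sigma T t) - f s - (sigma T t - s) *: d| <= e * `|sigma T t - s|.

Definition rd_continuous (V : normedModType R) T E (f : R -> V) :=
  forall t, E t ->
    (right_dense T t -> f s @[s --> within E (nbhs t)] --> f t) /\
    (left_dense T t ->
       exists l : V, f s @[s --> within (E `&` `]-oo, t[) (nbhs t)] --> l).

Definition antiderivative (V : normedModType R) T (f F : R -> V) :=
  forall t, kappa T t -> is_delta_derive T T F t (f t).

(* Cauchy delta integral F b - F a, for an antiderivative F of f on T. *)
Definition delta_int (V : normedModType R) T (f : R -> V) (a b : R) : V :=
  let F := xget (fun=> 0) [set F : R -> V | antiderivative T f F] in F b - F a.

(* x + mu(t) X(t,x) is invertible as a map from D onto its image. *)
Definition regressive n T (D : set 'rV[R]_n) (X : R -> 'rV[R]_n -> 'rV[R]_n) :=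
  forall t, kappa T t -> set_inj D (fun x => x + mu T t *: X t x).

(* [x] solves x^Delta = X(t,x), x(t1) = x1 on the interval [I] of [T] starting
   at [t1], staying in [D].  Solutions are forward in time: [x] is a function on
   [t1, +oo) in [T], so no left derivative is imposed at [t1]. *)
Definition is_solution n T (D : set 'rV[R]_n) (X : R -> 'rV[R]_n -> 'rV[R]_n)
    (t1 : R) (x1 : 'rV[R]_n) I (x : R -> 'rV[R]_n) :=
  x t1 = x1 /\
  forall t, I t ->
    D (x t) /\ is_delta_derive T (T `&` `[t1, +oo[) x t (X t (x t)).

(* Existence and uniqueness for the Cauchy problem.  Since [D] need not be open,
   local existence is required at interior points of [D] only. *)
Definition cauchy_well_posed n T (D : set 'rV[R]_n)
    (X : R -> 'rV[R]_n -> 'rV[R]_n) :=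
  (forall t1 x1, T t1 -> interior D x1 ->
     exists2 c, t1 < c &
     exists x, is_solution T D X t1 x1 (T `&` `[t1, c[) x) /\
  (forall t1 x1 c x y, T t1 -> D x1 ->
     is_solution T D X t1 x1 (T `&` `[t1, c[) x ->
     is_solution T D X t1 x1 (T `&` `[t1, c[) y ->
     forall t, T t -> t1 <= t < c -> x t = y t).

(* The partial operators delta_+ and delta_- are [delta true] and [delta false];
   each is a total function together with the domain [dom b] on which it is
   defined (with values in Ts), and is unspecified elsewhere. *)
Record shift_operators T (Ts : set R) (t0 : R)
    (dom : bool -> set (R * R)) (delta : bool -> R -> R -> R) : Prop := {
  shift_sub : Ts `<=` T ;
  shift_t0 : Ts t0 ;
  shift_dom : forall b s t, dom b (s, t) ->
    [/\ T s, t0 <= s, Ts t & Ts (delta b s t)] ;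
  shift_P1 : forall b s t u, dom b (s, t) -> dom b (s, u) ->
    t < u -> delta b s t < delta b s u ;
  shift_P2p : forall s r u, dom true (s, u) -> dom true (r, u) ->
    s < r -> delta true s u < delta true r u ;
  shift_P2m : forall s r u, dom false (s, u) -> dom false (r, u) ->
    s < r -> delta false r u < delta false s u ;
  shift_P3r : forall t, T t -> t0 <= t ->
    dom true (t, t0) /\ delta true t t0 = t ;
  shift_P3l : forall t, Ts t ->
    dom true (t0, t) /\ delta true t0 t = t ;
  shift_P4 : forall b s t, dom b (s, t) ->
    dom (~~ b) (s, delta b s t) /\ delta (~~ b) s (delta b s t) = t ;
  (* the first conclusion says that the inner term of the other two is defined *)
  shift_P5 : forall b s t u, dom b (s, t) -> dom (~~ b) (u, delta b s t) ->
    [/\ dom (~~ b) (u, t), dom b (s, delta (~~ b) u t)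
      & delta (~~ b) u (delta b s t) = delta b s (delta (~~ b) u t)]
}.

Definition shift_periods (Ts : set R) (t0 : R) (dom : bool -> set (R * R)) :
    set R :=
  [set p | [/\ Ts p, t0 < p & forall b t, Ts t -> dom b (p, t)]].

Definition periodic_in_shifts (Ts : set R) (t0 : R)
    (dom : bool -> set (R * R)) :=
  shift_periods Ts t0 dom !=set0.

Definition is_shift_period (Ts : set R) (t0 : R) (dom : bool -> set (R * R))
    (P : R) :=
  inf (shift_periods Ts t0 dom) = P /\ P <> t0.

(* [g] is the delta derivative of the shift by [p]. *)
Definition delta_periodic T (Ts : set R) (dom : bool -> set (R * R))
    (delta : bool -> R -> R -> R) (p : R) (f : R -> R) :=
  forall b,
    (forall t, Ts t -> dom b (p, t)) /\
    exists g : R -> R,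
      [/\ forall t, Ts t ->
            is_delta_derive T Ts (delta b p : R -> R^o) t (g t),
          rd_continuous T Ts (g : R -> R^o)
        & forall t, Ts t -> f (delta b p t) * g t = f t].

Definition shift_iter (delta : bool -> R -> R -> R) (p t0 : R) (i : nat) : R :=
  iter i (delta true p) t0.

Definition average n T (node : nat -> R) (X : R -> 'rV[R]_n -> 'rV[R]_n)
    (i : nat) (x : 'rV[R]_n) : 'rV[R]_n :=
  (node i.+1 - node i)^-1 *: delta_int T (X ^~ x) (node i) (node i.+1).

(* Piecewise constant in t: the average over the interval [node i, node i.+1)
   containing t. *)
Definition partial_average n T (node : nat -> R)
    (X : R -> 'rV[R]_n -> 'rV[R]_n) (t : R) (x : 'rV[R]_n) : 'rV[R]_n :=
  average T node X (xget 0%N [set i | node i <= t < node i.+1]) x.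

(* [x] solves x^Delta = X(t,x), x(node 0) = x0 where X may jump at the nodes:
   [x] is continuous on [node 0, +oo) in [T] and solves the equation on each
   [node i, node i.+1) separately.  At a node that is both left- and right-dense
   the two one-sided derivatives may differ, as they do when X jumps there. *)
Definition is_piecewise_solution n T (D : set 'rV[R]_n) (node : nat -> R)
    (X : R -> 'rV[R]_n -> 'rV[R]_n) (x0 : 'rV[R]_n) (x : R -> 'rV[R]_n) :=
  [/\ x (node 0%N) = x0,
      {within T `&` `[node 0%N, +oo[, continuous x}
    & forall i, is_solution T D X (node i) (x (node i))
        (kappa T `&` `[node i, node i.+1[) x].

End TimeScale.

(* Main.v *)
Require Import Defs.
From HB Require Import structures.
From mathcomp Require Import all_boot all_order all_algebra.
From mathcomp Require Import all_classical all_reals all_analysis.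
From mathcomp Require Import ring lra.
Import Order.TTheory GRing.Theory Num.Theory.
Import numFieldNormedType.Exports.
Local Open Scope classical_set_scope.
Local Open Scope ring_scope.

Set Implicit Arguments.
Unset Strict Implicit.
Unset Printing Implicit Defensive.

(** Freeze the averaged solution [xi] at the node [a] that starts a period and
    let [W t] be the integral from [a] to [t] of [X s (xi a)] minus its mean over
    the period. Then [W] is bounded by twice [M] times the length of the period,
    and it vanishes at both ends of the period. Subtracting [eps *: W] from
    [x - xi] removes the oscillating part of the derivative; what is left is
    bounded by [eps * lambda * (`|x - xi| + 2 * `|xi - xi a|)], and [xi] drifts
    by [O(eps)] during a period. Since [W] vanishes at the nodes, the corrected
    difference is continuous across them, so Gronwall's inequality on a time
    scale ([delta_gronwall]) applies period by period ([period_estimate]) and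
    chains without loss over the time [L / eps] ([averaging_error]). The
    contributions of the periods are of order [eps ^ 2] times their lengths, and
    the lengths add up to at most [L / eps].

    Three further points complete the argument. The means are defined through an
    antiderivative on [T]; one exists because an rd-continuous bounded function,
    made constant on the gaps of [T], is right-continuous and so Lebesgue
    integrable, and its primitive is an antiderivative ([antiderivative_exists]).
    The nodes tend to infinity by the shift axioms ([node_unbounded]), so the
    periods cover all later times. Finally [x] lives up to time [L / eps]: as
    long as it exists it is within [C * eps < r] of [xi], hence in the interior
    of [D], where the local existence theorem and the boundedness of the field
    let it be continued ([solution_exists]). *)

(** * Forward jump and induction along a time scale *)

Section Jump.
Context {R : realType}.
Variable T : set R.
Hypotheses (cT : closed T) (ubT : unbounded_above T).
Implicit Types (a b s t : R).

Lemma closed_sup (S : set R) : S `<=` T -> has_sup S -> T (sup S).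
Proof.
move=> ST [S0 Sb]; apply: cT.
by have := closure_sup S0 Sb; apply: closure_subset.
Qed.

Lemma sigmaE t : sigma T t = inf [set s | T s /\ t < s].
Proof.
by rewrite /sigma; case: asboolP => // -[]; exact: ubT.
Qed.

Let has_inf_later t : has_inf [set s | T s /\ t < s].
Proof.
by split; [have [s Ts ts] := ubT t; exists s | exists t => s [_ /ltW]].
Qed.

Lemma sigma_ge t : t <= sigma T t.
Proof.
by rewrite sigmaE; apply: lb_le_inf => [|s [_ /ltW]//]; case: (has_inf_later t).
Qed.

Lemma sigma_le t s : T s -> t < s -> sigma T t <= s.
Proof.
by move=> Ts ts; rewrite sigmaE; apply: ge_inf => //; case: (has_inf_later t).
Qed.

Lemma sigma_in t : T t -> T (sigma T t).
Proof.
move=> Tt; apply: cT => B /nbhs_ballP [e /= e0 eB].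
have [s [Ts ts]] := inf_adherent e0 (has_inf_later t).
rewrite -sigmaE => se; exists s; split => //; apply: eB.
by rewrite /ball /= ltr_distlC; have := sigma_le Ts ts; move: e0 se; lra.
Qed.

Lemma lt_sigma_le t s : T s -> s < sigma T t -> s <= t.
Proof.
by move=> Ts; apply: contraTT; rewrite -!ltNge => ?; rewrite ltNge negbK sigma_le.
Qed.

Lemma sigma_dense t e : sigma T t = t -> 0 < e -> exists2 s, T s & t < s < t + e.
Proof.
move=> tE e0; have [s [Ts ts]] := inf_adherent e0 (has_inf_later t).
by rewrite -sigmaE tE => se; exists s => //; rewrite ts se.
Qed.

Lemma sigma_right_dense t : sigma T t = t -> right_dense T t.
Proof. by move=> h; split => //; exact: ubT. Qed.

Lemma kappaE : kappa T = T.
Proof.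
apply/seteqP; split => [t [//]|t Tt]; split => // -[h _].
by have [s Ts] := ubT t; rewrite ltNge h.
Qed.

(** The supremum of the points up to which [P] holds is a point of [T]. Either it
    is attained, or it is left-dense and the third step applies; if it were below
    [t], the first or the second step would give a further such point. *)
Lemma timescale_induction a b (P : R -> Prop) : T a -> P a ->
  (forall t, T t -> a <= t < b -> t < sigma T t -> P t -> P (sigma T t)) ->
  (forall t, T t -> a <= t < b -> sigma T t = t -> P t ->
     exists2 c, t < c & forall s, T s -> t < s < c -> P s) ->
  (forall t, T t -> a < t <= b ->
     (forall e, 0 < e -> exists2 s, T s & t - e < s < t) ->
     (forall s, T s -> a <= s < t -> P s) -> P t) ->
  forall t, T t -> a <= t <= b -> P t.
Proof.
move=> Ta Pa Psc Pd Pl t Tt /andP[at_ tb].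
pose S := [set s | [/\ T s, a <= s, s <= t & forall u, T u -> a <= u <= s -> P u]].
have Sa : S a by split => // u _ /le_anti <-.
have hS : has_sup S by split; [exists a|exists t => s []].
have Tc : T (sup S) by apply: closed_sup => // s [].
have ac : a <= sup S by apply: ub_le_sup => //; case: hS.
have ct : sup S <= t by apply: ge_sup; [case: hS|move=> s []].
have below u : T u -> a <= u < sup S -> P u.
  move=> Tu /andP[au uc].
  have : 0 < sup S - u by rewrite subr_gt0.
  move=> /sup_adherent => /(_ S hS)[s [Ts _ _ Ps]]; rewrite subKr => us.
  by apply: Ps; rewrite // au ltW.
have Sc : S (sup S).
  have [//|nS] := pselect (S (sup S)).
  have ac' : a < sup S.
    by rewrite lt_neqAle ac andbT; apply/eqP => h; apply: nS; rewrite -h.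
  have Pc : P (sup S).
    apply: Pl => //; first by rewrite ac' (le_trans ct tb).
      move=> e /sup_adherent => /(_ S hS)[s Ss es]; exists s; first by case: Ss.
      rewrite es /= lt_neqAle; apply/andP; split.
        by apply/eqP => h; apply: nS; rewrite -h.
      by apply: ub_le_sup => //; case: hS.
  split => // u Tu /andP[au]; rewrite le_eqVlt => /predU1P[-> //|uc].
  by apply: below; rewrite // au.
have [_ _ _ Pc] := Sc.
move: ct; rewrite le_eqVlt => /predU1P[<-|ct]; first by apply: Pc; rewrite // ac lexx.
exfalso.
have cab : a <= sup S < b by rewrite ac (lt_le_trans ct).
have notS s : sup S < s -> ~ S s.
  by move=> cs Ss; move: cs; rewrite ltNge ub_le_sup//; case: hS.
have Pcc : P (sup S) by apply: Pc; rewrite // ac lexx.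
have := sigma_ge (sup S); rewrite le_eqVlt => /predU1P[/esym cE|csc].
  have [d cd Pd'] := Pd _ Tc cab cE Pcc.
  have m0 : 0 < Num.min d t - sup S by rewrite subr_gt0 lt_min cd ct.
  have [s Ts /andP[cs]] := sigma_dense cE m0.
  rewrite addrC subrK lt_min => /andP[sd st].
  apply: (notS _ cs); split => //; [exact: le_trans (ltW cs)|exact: ltW|].
  move=> u Tu /andP[au us]; have [uc|cu] := leP u (sup S).
    by apply: Pc; rewrite // au uc.
  by apply: Pd' => //; rewrite cu (le_lt_trans us).
apply: (notS _ csc); split.
- exact: sigma_in.
- exact: le_trans (ltW csc).
- exact: sigma_le.
- move=> u Tu /andP[au]; rewrite le_eqVlt => /predU1P[->|uc]; first exact: Psc.
  by apply: Pc; rewrite // au lt_sigma_le.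
Qed.
End Jump.

(** * Delta derivatives *)

Lemma near_dist (R : realType) (t d : R) : 0 < d -> \forall s \near t, `|t - s| < d.
Proof. by move=> d0; apply/nbhs_ballP; exists d. Qed.

Section DeltaDerivative.
Context {R : realType} {V : normedModType R}.
Implicit Types (T E : set R) (f g : R -> V) (t : R).

Let subr_regroup (x y z x' y' z' : V) :
  (x - x') - (y - y') - (z - z') = (x - y - z) - (x' - y' - z').
Proof. by rewrite !opprD !opprK (AC (2*2*2) ((1*3*5)*(2*4*6))). Qed.

Let subr_telescope (z x y a b : V) : x - y = (z - y - a) - (z - x - b) + (a - b).
Proof.
rewrite [- (_ - b)]opprB (AC (3*2*2) ((1*5*2)*((3*6)*(4*7)))).
by rewrite /= addNr subrr !addr0 subKr.
Qed.

(** The delta derivative at [t] sees the function only near [t] and at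
    [sigma T t]. This is what lets solutions be glued and truncated. *)
Lemma delta_derive_local T E E' f g t d :
  (\forall s \near t, E' s -> E s /\ g s = f s) -> g (sigma T t) = f (sigma T t) ->
  is_delta_derive T E f t d -> is_delta_derive T E' g t d.
Proof.
move=> EE gs fd e e0.
by apply: (filterS2 _ _ EE (fd e e0)) => s h1 h2 /h1[/h2 + ->]; rewrite gs.
Qed.

Lemma delta_deriveS T E E' f t d : E' `<=` E ->
  is_delta_derive T E f t d -> is_delta_derive T E' f t d.
Proof. by move=> EE fd e e0; apply: (filterS _ (fd e e0)) => s h /EE. Qed.

Lemma delta_deriveB T E f g t d d' :
  is_delta_derive T E f t d -> is_delta_derive T E g t d' ->
  is_delta_derive T E (f \- g) t (d - d').
Proof.
move=> fd gd e e0; have e2 : 0 < e / 2 by rewrite divr_gt0.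
apply: (filterS2 _ _ (fd _ e2) (gd _ e2)) => s h1 h2 Es /=.
rewrite scalerBr.
rewrite subr_regroup.
apply: le_trans (ler_normB _ _) _.
by apply: le_trans (lerD (h1 Es) (h2 Es)) _; rewrite -mulrDl -splitr.
Qed.

Lemma delta_deriveZ T E f t d (k : R) :
  is_delta_derive T E f t d -> is_delta_derive T E (fun s => k *: f s) t (k *: d).
Proof.
move=> fd e e0; have e2 : 0 < e / (`|k| + 1) by rewrite divr_gt0// ltr_wpDl.
apply: (filterS _ (fd _ e2)) => s h Es.
rewrite scalerA [_ * k]mulrC -scalerA -!scalerBr normrZ.
apply: le_trans (ler_wpM2l (normr_ge0 k) (h Es)) _.
rewrite mulrA ler_wpM2r// mulrA ler_pdivrMr ?ltr_wpDl// mulrC ler_wpM2l//; first exact: ltW.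
by rewrite lerDl.
Qed.

Lemma delta_derive_line T E (a : R) (c : V) t :
  is_delta_derive T E (fun s => (s - a) *: c) t c.
Proof.
move=> e e0; apply: filterE => s _ /=; rewrite -!scalerBl.
have -> : sigma T t - a - (s - a) - (sigma T t - s) = 0 by ring.
by rewrite scale0r normr0 mulr_ge0// ltW.
Qed.

Lemma delta_derive_cst T E (c : V) t : is_delta_derive T E (cst c) t 0.
Proof.
by move=> e e0; apply: filterE => s _ /=; rewrite scaler0 subr0 subrr normr0 mulr_ge0// ltW.
Qed.

Lemma delta_derive_subc T E f (c : V) t d :
  is_delta_derive T E f t d -> is_delta_derive T E (fun s => f s - c) t d.
Proof.
move=> fd; have := delta_deriveB fd (delta_derive_cst T E c t).
by rewrite (subr0 d).
Qed.

Lemma delta_derive_cvg T E f t d : E t -> is_delta_derive T E f t d ->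
  f s @[s --> within E (nbhs t)] --> f t.
Proof.
move=> Et fd; apply/cvgrPdist_le => e e0.
pose m := `|sigma T t - t|.
have m0 : 0 <= m by exact: normr_ge0.
have m1 : 0 < 2 * m + 1 by rewrite ltr_wpDl// mulr_ge0.
have d1 : 0 < `|d| + 1 by rewrite ltr_wpDl.
pose e' := e / 2 / (2 * m + 1).
have e'0 : 0 < e' by rewrite !divr_gt0.
have dl : 0 < Num.min 1 (e / 2 / (`|d| + 1)) by rewrite lt_min ltr01 !divr_gt0.
rewrite near_withinE.
apply: (filterS2 _ _ (near_dist t dl) (fd _ e'0)) => s.
rewrite lt_min => /andP[ts1 tsd] hs Es.
have ht := nbhs_singleton (fd _ e'0) Et.
rewrite (subr_telescope (f (sigma T t)) (f t) _ ((sigma T t - s) *: d) ((sigma T t - t) *: d)).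
rewrite -scalerBl (_ : _ - s - (_ - t) = t - s); last by ring.
have ms : `|sigma T t - s| <= m + 1.
  have -> : sigma T t - s = (sigma T t - t) + (t - s) by ring.
  by rewrite (le_trans (ler_normD _ _))// lerD// ltW.
rewrite [leRHS]splitr (le_trans (ler_normD _ _))// lerD//.
  apply: le_trans (ler_normB _ _) _.
  apply: le_trans (lerD (hs Es) ht) _.
  rewrite -mulrDr /e' mulrAC ler_pdivrMr// ler_wpM2l//; first by rewrite ltW// divr_gt0.
  by move: ms; rewrite -/m; lra.
rewrite normrZ; move: tsd; rewrite ltr_pdivlMr// => /ltW; apply: le_trans.
by rewrite ler_wpM2l// lerDl.
Qed.
End DeltaDerivative.

(** * Gronwall and mean value inequalities *)

Section Gronwall.
Context {R : realType} {V : normedModType R}.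
Variable T : set R.
Hypotheses (cT : closed T) (ubT : unbounded_above T).

(** After [a] the majorant [y] is convex and satisfies [y' >= al * y + be], so it
    outgrows its tangent on steps of any length; this covers the jumps of a time
    scale. Unlike the solution of [y' = al * y + be], which involves [be / al], it
    makes sense for [al = 0], where it is the bound of the mean value inequality. *)
Lemma gronwall_majorant_step (al be m0 a c s : R) :
  0 <= al -> 0 <= be -> 0 <= m0 -> a <= c -> c <= s ->
  (m0 + be * (c - a)) * expR (al * (c - a)) +
    (s - c) * (al * ((m0 + be * (c - a)) * expR (al * (c - a))) + be) <=
  (m0 + be * (s - a)) * expR (al * (s - a)).
Proof.
move=> al0 be0 m00 ac cs.
pose h := s - c; have h0 : 0 <= h by rewrite subr_ge0.
have -> : s - a = (c - a) + h by rewrite /h; ring.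
rewrite -/h [al * (c - a + h)]mulrDr expRD.
set E1 := expR (al * (c - a)).
have E11 : 1 <= E1.
  by rewrite -(expR0 R) ler_expR mulr_ge0// subr_ge0.
have Eh : 1 + al * h <= expR (al * h) by exact: expR_ge1Dx.
have A0 : 0 <= m0 + be * (c - a) by rewrite addr_ge0// mulr_ge0// subr_ge0.
have Bh : 0 <= be * h by rewrite mulr_ge0.
have ah : 0 <= al * h by rewrite mulr_ge0.
rewrite [be * (c - a + h)]mulrDr addrA.
set A := m0 + _ in A0 *; set B := be * h in Bh *.
apply: (@le_trans _ _ ((A + B) * (E1 * (1 + al * h)))); last first.
  have E10 : 0 <= E1 by exact: expR_ge0.
  by apply: ler_wpM2l; [rewrite addr_ge0|exact: ler_wpM2l].
have -> : h * (al * (A * E1) + be) = A * E1 * (al * h) + B by rewrite /B; ring.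
have -> : (A + B) * (E1 * (1 + al * h)) =
    A * E1 + A * E1 * (al * h) + B * (E1 * (1 + al * h)) by ring.
rewrite addrA lerD2l ler_peMr//.
by apply: (le_trans E11); rewrite ler_peMr ?lerDl// (le_trans ler01).
Qed.

(** With [be] enlarged by an arbitrary [e > 0] the inequality propagates by
    induction along [T]: [gronwall_majorant_step] covers the jumps, and the slack
    [e] absorbs the error of the linear approximation at right-dense points. *)
Lemma delta_gronwall (a b al be m0 : R) (v d : R -> V) :
  T a -> T b -> a <= b -> 0 <= al -> 0 <= be ->
  (forall t, T t -> a <= t < b -> is_delta_derive T (T `&` `[a, b]) v t (d t)) ->
  (forall t, T t -> a <= t < b -> `|d t| <= al * `|v t| + be) ->
  v s @[s --> within (T `&` `[a, b]) (nbhs b)] --> v b ->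
  `|v a| <= m0 ->
  `|v b| <= (m0 + be * (b - a)) * expR (al * (b - a)).
Proof.
move=> Ta Tb ab al0 be0 vd db vb va.
have m00 : 0 <= m0 by exact: le_trans va.
suff main e : 0 < e ->
    `|v b| <= (m0 + (be + e) * (b - a)) * expR (al * (b - a)).
  apply/ler_addgt0Pr => e e0.
  pose k := (b - a) * expR (al * (b - a)).
  have k0 : 0 <= k by rewrite mulr_ge0 ?subr_ge0// expR_ge0.
  have k1 : 0 < k + 1 by rewrite ltr_wpDl.
  have e1 : 0 < e / (k + 1) by rewrite divr_gt0.
  apply: le_trans (main _ e1) _.
  have -> : (m0 + (be + e / (k + 1)) * (b - a)) * expR (al * (b - a)) =
     (m0 + be * (b - a)) * expR (al * (b - a)) + e / (k + 1) * k by rewrite /k; ring.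
  by rewrite lerD2l mulrAC ler_pdivrMr// ler_wpM2l ?lerDl// ltW.
move=> e0.
pose y t := (m0 + (be + e) * (t - a)) * expR (al * (t - a)).
have be'0 : 0 <= be + e by rewrite addr_ge0// ltW.
have ystep c s : a <= c -> c <= s -> y c + (s - c) * (al * y c + (be + e)) <= y s.
  by move=> ac cs; apply: gronwall_majorant_step.
have step c s : T c -> a <= c < b -> c <= s -> `|v c| <= y c ->
    `|v s - v c - (s - c) *: d c| <= e * (s - c) -> `|v s| <= y s.
  move=> Tc cab cs vc h.
  apply: le_trans (ystep _ _ _ cs); last by case/andP: cab.
  have -> : v s = v c + (s - c) *: d c + (v s - v c - (s - c) *: d c).
    by rewrite addrC -[v s - _ - _]addrA -opprD subrK.
  have sc : 0 <= s - c by rewrite subr_ge0.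
  apply: le_trans (ler_normD _ _) _; apply: le_trans (lerD (ler_normD _ _) h) _.
  rewrite normrZ ger0_norm//.
  have -> : (s - c) * (al * y c + (be + e)) =
      (s - c) * (al * y c + be) + (s - c) * e by ring.
  rewrite addrA [e * _]mulrC lerD2r lerD//; apply: ler_wpM2l => //.
  by apply: le_trans (db _ Tc cab) _; rewrite lerD2r ler_wpM2l.
apply: (@timescale_induction _ _ cT ubT a b (fun t => `|v t| <= y t)) => //.
- by rewrite /y subrr !mulr0 addr0 expR0 mulr1.
- move=> t Tt atb tst vt; apply: (step t) => //; first exact: ltW.
  have := nbhs_singleton (vd _ Tt atb _ e0).
  rewrite [`|sigma T t - t|]ger0_norm; last by rewrite subr_ge0 ltW.
  by apply; split => //=; rewrite in_itv /=; case/andP: atb => -> /ltW.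
- move=> t Tt atb tst vt; have [at_ tb] := andP atb.
  have := vd _ Tt atb _ e0; rewrite tst => /nbhs_ballP[dl /= dl0 hd].
  exists (Num.min b (t + dl)); first by rewrite lt_min tb ltrDl.
  move=> s Ts /andP[ts]; rewrite lt_min => /andP[sb sdl].
  apply: (step t) => //; first exact: ltW.
  have := hd s; rewrite /ball /= ltr_distlC.
  have -> : t - dl < s < t + dl by rewrite sdl andbT; move: ts dl0; lra.
  move=> /(_ isT).
  rewrite [`|t - s|]distrC [`|s - t|]ger0_norm; last by rewrite subr_ge0 ltW.
  rewrite -normrN opprD opprK opprB -[t - s]opprB scaleNr; apply.
  by split => //=; rewrite in_itv /= (ltW sb) (le_trans at_ (ltW ts)).
- move=> t Tt /andP[at_ tb] tl Pt.
  have vt : v s @[s --> within (T `&` `[a, b]) (nbhs t)] --> v t.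
    move: tb; rewrite le_eqVlt => /predU1P[->//|tb].
    by apply: delta_derive_cvg (vd _ Tt _); [split => //=; rewrite in_itv /= !ltW|rewrite ltW].
  apply/ler_addgt0Pr => e2 e20.
  have /cvgrPdist_le /(_ _ e20) := vt.
  rewrite near_withinE => /nbhs_ballP[dl /= dl0 hd].
  have m0' : 0 < Num.min dl (t - a) by rewrite lt_min dl0 subr_gt0.
  have [s Ts /andP[ts st]] := tl _ m0'.
  have [tdl as_] : t - dl < s /\ a < s.
    move: ts; rewrite ltrBlDl -ltrBlDr lt_min => /andP[]; lra.
  have vts : `|v t - v s| <= e2.
    apply: (hd s); first by rewrite /ball /= ltr_distlC tdl; move: st dl0; lra.
    by split => //=; rewrite in_itv /= (ltW as_) (le_trans (ltW st) tb).
  have -> : v t = v s + (v t - v s) by rewrite addrC subrK.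
  apply: le_trans (ler_normD _ _) _; rewrite lerD//.
  apply: le_trans (Pt _ Ts _) _; first by rewrite ltW.
  apply: le_trans (ystep _ _ (ltW as_) (ltW st)); rewrite lerDl.
  rewrite mulr_ge0 ?subr_ge0 ?(ltW st)// addr_ge0// mulr_ge0//.
  by rewrite mulr_ge0 ?expR_ge0// addr_ge0// mulr_ge0// subr_ge0 ltW.
- by rewrite ab lexx.
Qed.
End Gronwall.

Lemma cvg_withinS (S : topologicalType) (U : nbhsType) (A B : set S)
    (x : S) (f : S -> U) (l : U) :
  A `<=` B -> f s @[s --> within B (nbhs x)] --> l ->
  f s @[s --> within A (nbhs x)] --> l.
Proof.
move=> AB h P /h hP.
exact: (@filterS _ (nbhs x) _ _ _ (fun s hs As => hs (AB _ As)) hP).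
Qed.

Lemma itvS {R : realType} (T : set R) (a b c d : R) :
  a <= c -> d <= b -> (T `&` `[c, d]) `<=` (T `&` `[a, b]).
Proof.
move=> ac db s [Ts /=]; rewrite in_itv /= => /andP[cs sd].
by split => //=; rewrite in_itv /= (le_trans ac cs) (le_trans sd db).
Qed.

Lemma itvyS {R : realType} (T : set R) (a c d : R) :
  a <= c -> (T `&` `[c, d]) `<=` (T `&` `[a, +oo[).
Proof.
move=> ac s [Ts /=]; rewrite in_itv /= => /andP[cs sd].
by split => //=; rewrite in_itv /= andbT (le_trans ac cs).
Qed.

Section MeanValue.
Context {R : realType} {V : normedModType R}.
Variable T : set R.
Hypotheses (cT : closed T) (ubT : unbounded_above T).

Lemma delta_mean_value (a b M : R) (v d : R -> V) :
  T a -> T b -> a <= b -> 0 <= M ->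
  (forall t, T t -> a <= t < b -> is_delta_derive T (T `&` `[a, b]) v t (d t)) ->
  (forall t, T t -> a <= t < b -> `|d t| <= M) ->
  v s @[s --> within (T `&` `[a, b]) (nbhs b)] --> v b ->
  `|v b - v a| <= M * (b - a).
Proof.
move=> Ta Tb ab M0 vd dM vb.
have := @delta_gronwall _ _ _ cT ubT a b 0 M 0 (v \- cst (v a)) d Ta Tb ab (lexx _) M0.
rewrite /= subrr normr0 !mul0r add0r expR0 mulr1; apply => //.
- by move=> t Tt abt; apply: delta_derive_subc; exact: vd.
- by move=> t Tt abt; rewrite mul0r add0r dM.
- by apply: cvgB => //; exact: cvg_cst.
Qed.

Lemma antiderivative_cvg (f F : R -> V) E t : antiderivative T f F -> T t -> E `<=` T ->
  F s @[s --> within E (nbhs t)] --> F t.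
Proof.
move=> fF Tt ET; have kt : kappa T t by rewrite kappaE.
exact: cvg_withinS (delta_derive_cvg Tt (fF t kt)).
Qed.

Lemma antiderivative_increment (f F : R -> V) (a b M : R) :
  antiderivative T f F -> T a -> T b -> a <= b -> 0 <= M ->
  (forall t, T t -> `|f t| <= M) -> `|F b - F a| <= M * (b - a).
Proof.
move=> fF Ta Tb ab M0 fM; apply: (@delta_mean_value _ _ _ F f) => //.
- move=> t Tt _; apply: (@delta_deriveS _ _ T T) => [s []//|].
  by apply: fF; rewrite kappaE.
- by move=> t Tt _; exact: fM.
- have aux : (T `&` `[a, b]) `<=` T by move=> s [].
  exact: (antiderivative_cvg fF Tb aux).
Qed.
End MeanValue.

(** * Integrals of right-continuous functions *)

Section RightContinuous.
Context {R : realType}.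
Implicit Types (g h : R -> R) (s a b c e : R).
Local Notation mu := (@lebesgue_measure R).

Lemma measurable_fun_floor (h : int -> R) a : 0 < a ->
  measurable_fun setT (fun s : R => h (Num.floor (a * s))).
Proof.
move=> a0 _ B _; rewrite setTI.
have -> : (fun s : R => h (Num.floor (a * s))) @^-1` B =
    \bigcup_(z : int) (if `[< B (h z) >] then `[z%:~R / a, (z + 1)%:~R / a[%classic else set0).
  apply/seteqP; split => [s /= Bs|s [z _] /=].
    exists (Num.floor (a * s)) => //=.
    rewrite asboolT//= in_itv /= ler_pdivrMr// ltr_pdivlMr// [s * a]mulrC.
    exact: floor_itv.
  case: asboolP => [Bz /=|_ []//].
  by rewrite in_itv /= ler_pdivrMr// ltr_pdivlMr// [s * a]mulrC => /floor_def ->.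
apply: countable_bigcupT_measurable; first exact: countableP.
by move=> z; case: ifP => _; [exact: measurable_itv|exact: measurable0].
Qed.

(** Sampling at the next multiple of [1 / (k + 1)] gives step functions that
    converge pointwise, since the sample points approach from the right. *)
Lemma right_continuous_measurable g :
  (forall s, g u @[u --> s^'+] --> g s) -> measurable_fun setT g.
Proof.
move=> gr.
pose q (k : nat) (s : R) : R := (Num.floor (k.+1%:R * s) + 1)%:~R / k.+1%:R.
have q_bounds k s : s < q k s <= s + k.+1%:R^-1.
  have k0 : 0 < k.+1%:R :> R by rewrite ltr0n.
  have /andP[h1 h2] := floor_itv (k.+1%:R * s : R).
  rewrite /q ltr_pdivlMr// ler_pdivrMr// mulrDl mulVf ?gt_eqF// [s * _]mulrC h2 /=.
  by rewrite intrD lerD2r.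
apply: (@measurable_realfun.measurable_fun_cvg _ _ _ _ (fun k s => g (q k s))).
  move=> k; apply: (@measurable_fun_floor (fun z => g ((z + 1)%:~R / k.+1%:R)) k.+1%:R).
  by rewrite ltr0n.
move=> s _.
have /cvg_at_rightP := gr s; apply; split => [k|]; first by case/andP: (q_bounds k s).
apply: (@squeeze_cvgr _ _ _ _ (cst s) (fun k => s + k.+1%:R^-1)).
- by apply: nearW => k; case/andP: (q_bounds k s) => /ltW -> ->.
- exact: cvg_cst.
- rewrite -[X in _ --> X]addr0; apply: cvgD; first exact: cvg_cst.
  exact: cvg_harmonic.
Qed.

Section Integral.
Variables (g : R -> R) (M : R).
Hypotheses (mg : measurable_fun setT g) (gM : forall s, `|g s| <= M).

Let integrable_itv a b : mu.-integrable `[a, b[ (EFin \o g).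
Proof.
apply: measurable_bounded_integrable => //.
- by rewrite /= lebesgue_measure_itv /=; case: ifP => _; rewrite ?ltry.
- exact: measurable_funS mg.
- by exists M; split; [exact: num_real|move=> x Mx s _; apply: le_trans (gM s) _; exact: ltW].
Qed.

(** An interval with its bounds in the wrong order is empty, so one of the two
    terms vanishes and the difference is the oriented integral from [0] to [t]. *)
Definition primitive (t : R) : R :=
  \int[mu]_(s in `[0, t[) g s - \int[mu]_(s in `[t, 0[) g s.

Let Rintegral_cat a b c : a <= b -> b <= c ->
  \int[mu]_(s in `[a, c[) g s = \int[mu]_(s in `[a, b[) g s + \int[mu]_(s in `[b, c[) g s.
Proof.
move=> ab bc; rewrite (@itv_bndbnd_setU _ _ (BLeft a) (BLeft b) (BLeft c)) ?bnd_simp//.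
apply: Rintegral_setU => //.
  by rewrite -itv_bndbnd_setU ?bnd_simp.
apply/disj_setPS => s [] /=; rewrite !in_itv /= => /andP[_ sb].
by move=> /andP[/(lt_le_trans sb)]; rewrite ltxx.
Qed.

Let Rintegral_nil a b : b <= a -> \int[mu]_(s in `[a, b[) g s = 0.
Proof. by move=> ba; rewrite set_itv_ge ?Rintegral_set0// bnd_simp -leNgt. Qed.

Lemma primitiveB a b : a <= b -> primitive b - primitive a = \int[mu]_(s in `[a, b[) g s.
Proof.
move=> ab; rewrite /primitive; have [a0|/ltW a0] := leP 0 a.
  rewrite (Rintegral_nil a0) (Rintegral_nil (le_trans a0 ab)) (Rintegral_cat a0 ab); lra.
have [b0|/ltW b0] := leP 0 b.
  rewrite (Rintegral_nil a0) (Rintegral_nil b0) (Rintegral_cat a0 b0); lra.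
rewrite (Rintegral_nil a0) (Rintegral_nil b0) (Rintegral_cat ab b0); lra.
Qed.

Lemma primitive_approx a b c e : a <= b -> (forall s, a <= s < b -> `|g s - c| <= e) ->
  `|primitive b - primitive a - (b - a) * c| <= e * (b - a).
Proof.
move=> ab gc; rewrite primitiveB//.
have cst_int k : \int[mu]_(s in `[a, b[) (cst k) s = (b - a) * k.
  rewrite Rintegral_cst//= lebesgue_measure_itv /= lte_fin.
  move: ab; rewrite le_eqVlt => /predU1P[->|ab]; first by rewrite ltxx subrr mulr0 mul0r.
  by rewrite ab /= mulrC.
have int_cst k : mu.-integrable `[a, b[ (EFin \o cst k).
  apply: measurable_bounded_integrable => //.
  - by rewrite /= lebesgue_measure_itv /=; case: ifP => _; rewrite ?ltry.
  - exact: bounded_cst.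
have int_sub : mu.-integrable `[a, b[ (EFin \o (fun s => g s - c)).
  by apply: (integrableB _ (integrable_itv a b) (int_cst c)).
rewrite -cst_int -RintegralB// [e * _]mulrC -cst_int.
apply: le_trans (le_normr_Rintegral _ int_sub) _ => //.
apply: le_Rintegral => //; first exact: integrable_norm.
Qed.
End Integral.
End RightContinuous.

(** * Existence of antiderivatives *)

Section MatrixNorm.
Context {R : realType} {m n : nat}.
Implicit Type x : 'M[R]_(m, n).

Lemma mx_entry_le_norm x i j : `|x i j| <= `|x|.
Proof.
rewrite [leRHS]/Num.norm /= mx_normrE; apply/bigmax_geP; right => /=.
by exists (i, j).
Qed.

Lemma mx_norm_le x (e : R) : 0 <= e -> (forall i j, `|x i j| <= e) -> `|x| <= e.
Proof.
by move=> e0 xe; rewrite [leLHS]/Num.norm /= mx_normrE; apply/bigmax_leP; split.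
Qed.
End MatrixNorm.

Section Antiderivative.
Context {R : realType}.
Variable T : set R.
Hypotheses (cT : closed T) (ubT : unbounded_above T).
Implicit Types (s t u e : R).

(** The backward projection onto [T]. Where [T] has no point up to [s], the
    supremum is a junk value, and [step_extension] below is constant there. *)
Definition last_point s : R := sup (T `&` [set u | u <= s]).

Lemma last_point_between s u : T s -> s <= u ->
  T (last_point u) /\ s <= last_point u <= u.
Proof.
move=> Ts su.
have hS : has_sup (T `&` [set v | v <= u]) by split; [exists s|exists u => v []].
split; first by apply: closed_sup => // v [].
apply/andP; split; first by apply: ub_le_sup => //; case: hS.
by apply: ge_sup; [case: hS|move=> v []].
Qed.

Lemma last_point_id t : T t -> last_point t = t.
Proof.
by move=> Tt; apply/le_anti/andP; have [_ /andP[]] := last_point_between Tt (lexx t).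
Qed.

Lemma last_point_gap s u : s <= u -> (forall t, T t -> s < t -> u < t) ->
  last_point u = last_point s.
Proof.
move=> su gap; rewrite /last_point; congr sup.
apply/seteqP; split => v [Tv /= vu]; split => //=.
  by rewrite leNgt; apply/negP => /(gap _ Tv); rewrite ltNge vu.
exact: le_trans su.
Qed.

Section Scalar.
Variables (f : R -> R) (M : R).
Hypotheses (fM : forall t, T t -> `|f t| <= M).
Hypothesis frd : forall t, T t -> right_dense T t -> f s @[s --> within T (nbhs t)] --> f t.

(** Constant on the gaps of [T], so that its Lebesgue integral between points of
    [T] is the delta integral of [f]. *)
Definition step_extension s : R := (f \_ T) (last_point s).

Let extension_id t : T t -> step_extension t = f t.
Proof. by move=> Tt; rewrite /step_extension last_point_id// patchE mem_set. Qed.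

Let extension_bound s : `|step_extension s| <= Num.max M 0.
Proof.
rewrite /step_extension patchE; case: ifPn => [/set_mem /fM h|_].
  by rewrite le_max h.
by rewrite normr0 le_max lexx orbT.
Qed.

(* The point [s] keeps the projection of [u] to [T] from falling far below [t]. *)
Let extension_near t e : T t -> right_dense T t -> 0 < e ->
  exists2 d, 0 < d & forall s u, T s -> s <= t -> s <= u -> `|t - s| < d -> `|t - u| < d ->
    `|step_extension u - f t| <= e.
Proof.
move=> Tt td e0; have /cvgrPdist_le /(_ _ e0) := frd Tt td.
rewrite near_withinE => /nbhs_ballP[d /= d0 hd]; exists d => // s u Ts st su sd ud.
have [Tl /andP[sl lu]] := last_point_between Ts su.
rewrite /step_extension patchE mem_set// distrC; apply: hd => //.
rewrite /ball /=; move: sd ud; rewrite !ltr_distlC; move: sl lu; lra.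
Qed.

Let extension_right s : step_extension u @[u --> s^'+] --> step_extension s.
Proof.
apply/cvgrPdist_le => e e0.
have [[d d0 gap]|dense] := pselect (exists2 d, 0 < d & forall t, T t -> s < t -> s + d <= t).
  near=> u.
  have su : s < u by near: u; exact: nbhs_right_gt.
  have ud : u < s + d by near: u; apply: nbhs_right_lt; rewrite ltrDl.
  rewrite /step_extension (last_point_gap (ltW su)); last first.
    by move=> t Tt st; apply: lt_le_trans ud (gap _ Tt st).
  by rewrite subrr normr0 ltW.
have later d : 0 < d -> exists2 t, T t & s < t < s + d.
  move=> d0; apply: contrapT => h; apply: dense; exists d => // t Tt st.
  by rewrite leNgt; apply/negP => td; apply: h; exists t; rewrite // st td.
have Ts : T s.
  apply: cT => B /nbhs_ballP[d /= d0 dB]; have [t Tt /andP[st td]] := later _ d0.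
  by exists t; split => //; apply: dB; rewrite /ball /= ltr_distlC td andbT; move: st d0; lra.
have sE : sigma T s = s.
  apply/le_anti; rewrite sigma_ge// andbT; apply/ler_addgt0Pr => d /later[t Tt /andP[st td]].
  by rewrite (le_trans (sigma_le ubT Tt st))// ltW.
have [d d0 hd] := extension_near Ts (sigma_right_dense ubT sE) e0.
near=> u.
have su : s < u by near: u; exact: nbhs_right_gt.
have ud : u < s + d by near: u; apply: nbhs_right_lt; rewrite ltrDl.
rewrite extension_id// distrC; apply: (hd s) => //; rewrite ?subrr ?normr0// ?ltW//.
by rewrite ltr_distlC ud andbT; have := d0; have := su; lra.
Unshelve. all: by end_near. Qed.

(** Across a jump the integrand is constant; near a right-dense point it is close
    to its value there. At a left-dense right-scattered point [f] may be
    discontinuous, but [sigma T t - s] stays away from [0], so that continuity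
    of the primitive suffices, and this follows from the bound on [f]. *)
Lemma primitive_step_extension :
  antiderivative T (f : R -> R^o) (primitive step_extension).
Proof.
have mg := right_continuous_measurable extension_right.
have approx a b c e ab := @primitive_approx _ _ _ mg extension_bound a b c e ab.
move=> t; rewrite kappaE// => Tt e e0.
have := sigma_ge ubT t; rewrite le_eqVlt => /predU1P[/esym tE|tst].
  rewrite tE; have [d d0 hd] := extension_near Tt (sigma_right_dense ubT tE) e0.
  apply: filterS (near_dist t d0) => s tsd Ts; rewrite -[_ *: _]/(_ * _).
  have [st|/ltW ts] := leP s t.
    rewrite [`|t - s|]ger0_norm ?subr_ge0//; apply: approx => // u /andP[su ut].
    apply: (hd s) => //; move: tsd; rewrite !ltr_distlC; move: su ut; lra.
  have := approx t s (f t) e ts.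
  rewrite -normrN [`|t - s|]distrC [`|s - t|]ger0_norm ?subr_ge0//.
  have -> : - (primitive step_extension t - primitive step_extension s - (t - s) * f t) =
    primitive step_extension s - primitive step_extension t - (s - t) * f t by ring.
  apply => u /andP[tu us]; apply: (hd t); rewrite ?subrr ?normr0//.
  by move: tsd; rewrite !ltr_distlC; move: tu us; lra.
(* [N - 1] bounds the distance of the integrand to [f t]; adding [1] makes [N]
   positive *)
pose N := Num.max M 0 + `|f t| + 1.
have N0 : 0 < N by rewrite /N ltr_wpDl// addr_ge0// le_max lexx orbT.
have m0 : 0 < sigma T t - t by rewrite subr_gt0.
have d0 : 0 < Num.min (sigma T t - t) (e * (sigma T t - t) / N).
  by rewrite lt_min m0 divr_gt0// mulr_gt0.
apply: filterS (near_dist t d0) => s; rewrite lt_min => /andP[ts1 ts2] Ts.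
rewrite -[_ *: _]/(_ * _).
have st : s <= t.
  apply: (lt_sigma_le ubT Ts); move: ts1; rewrite ltr_distlC; lra.
have jump := approx t (sigma T t) (f t) 0 (ltW tst).
have jump0 : primitive step_extension (sigma T t) - primitive step_extension t =
    (sigma T t - t) * f t.
  apply/eqP; rewrite -subr_eq0 -normr_le0 -[leRHS](mul0r (sigma T t - t)).
  apply: jump => s' /andP[ts' s's]; rewrite /step_extension (@last_point_gap t s')//.
    by rewrite -/(step_extension t) extension_id// subrr normr0.
  by move=> v Tv tv; rewrite (lt_le_trans s's)// sigma_le.
have := approx s t (f t) (N - 1) st.
have -> : primitive step_extension (sigma T t) - primitive step_extension s -
      (sigma T t - s) * f t =
    primitive step_extension t - primitive step_extension s - (t - s) * f t.
  by move: jump0; lra.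
move=> h; apply: le_trans (h _) _.
  by move=> u _; rewrite /N addrK (le_trans (ler_normB _ _))// lerD2r extension_bound.
have ts0 : 0 <= t - s by rewrite subr_ge0.
rewrite ger0_norm; last by rewrite subr_ge0 (le_trans st) ?ltW.
move: ts2; rewrite ger0_norm// ltr_pdivlMr// => /ltW ts2.
apply: (@le_trans _ _ ((t - s) * N)); first by rewrite mulrC ler_wpM2l// gerBl.
by apply: le_trans ts2 _; apply: ler_wpM2l; [exact: ltW|rewrite lerD2l lerN2].
Qed.
End Scalar.

Lemma antiderivative_exists n (f : R -> 'rV[R]_n) (M : R) :
  (forall t, T t -> `|f t| <= M) -> rd_continuous T T f ->
  exists F, antiderivative T f F.
Proof.
move=> fM frd.
have comp j : exists F : R -> R, antiderivative T (fun t => f t ord0 j : R^o) F.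
  exists (primitive (step_extension (fun t => f t ord0 j))).
  apply: (@primitive_step_extension _ M).
    by move=> t /fM; apply: le_trans; exact: mx_entry_le_norm.
  move=> t Tt td; apply/cvgrPdist_le => e e0.
  have /cvgrPdist_le /(_ _ e0) := (frd t Tt).1 td.
  apply: filterS => s; apply: le_trans.
  by have := mx_entry_le_norm (f t - f s) ord0 j; rewrite !mxE.
have [F hF] := choice comp.
exists (fun t => \row_j F j t) => t kt e e0.
have near_all := @filter_forall _ 'I_n _ (nbhs t) (nbhs_filter t) (fun j => hF j t kt e e0).
apply: (filterS _ near_all) => s h Ts; apply: mx_norm_le => [|i j].
  by rewrite mulr_ge0// ltW.
by rewrite ord1 !mxE; exact: h.
Qed.
End Antiderivative.

(** * Nodes of the period partition *)

Section Nodes.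
Context {R : realType}.
Variables (T Ts : set R) (t0 p : R).
Variables (dom : bool -> set (R * R)) (delta : bool -> R -> R -> R).
Hypotheses (cT : closed T) (shiftT : shift_operators T Ts t0 dom delta).
Hypotheses (Tsp : Ts p) (t0p : t0 < p) (domp : forall b t, Ts t -> dom b (p, t)).
Local Notation node := (shift_iter delta p t0).

Lemma node_in i : Ts (node i).
Proof.
elim: i => [|i IH] /=; first exact: shift_t0 shiftT.
by have [] := shift_dom shiftT (domp true IH).
Qed.

Lemma node_inT i : T (node i). Proof. exact: (shift_sub shiftT) (node_in i). Qed.

Lemma node_ltS i : node i < node i.+1.
Proof.
elim: i => [|i IH] /=.
  by have [_ ->] := shift_P3r shiftT (shift_sub shiftT Tsp) (ltW t0p).
exact: shift_P1 shiftT _ _ _ _ (domp true (node_in i)) (domp true (node_in i.+1)) IH.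
Qed.

(** A finite supremum [nu] of the nodes would lie in [Ts], because every point of
    [T] after [t0] is a shift of [t0], namely by itself. Some node would then
    exceed [delta false p nu < nu], and the next node would exceed [nu]. *)
Lemma node_unbounded t : exists i, t < node i.
Proof.
apply: contrapT => h.
have hS : has_sup (range node).
  split; first by exists (node 0%N), 0%N.
  by exists t => _ [i _ <-]; rewrite leNgt; apply/negP => ti; apply: h; exists i.
pose nu := sup (range node).
have node_le i : node i <= nu by apply: ub_le_sup; [case: hS|exists i].
have Tnu : T nu by apply: closed_sup => // _ [i _ <-]; exact: node_inT.
have [d1 e1] := shift_P3r shiftT Tnu (node_le 0%N).
have Tsnu : Ts nu by have [_ _ _] := shift_dom shiftT d1; rewrite e1.
have [d2 e2] := shift_P3l shiftT Tsnu.
have [d3 e3] := shift_P4 shiftT d2; rewrite /= e2 in d3 e3.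
have below := shift_P2m shiftT d3 (domp false Tsnu) t0p; rewrite e3 in below.
have [d4 e4] := shift_P4 shiftT (domp false Tsnu).
have : 0 < nu - delta false p nu by rewrite subr_gt0.
move=> /sup_adherent => /(_ _ hS)[_ [i _ <-]]; rewrite subKr => wi.
have := shift_P1 shiftT d4 (domp true (node_in i)) wi.
by rewrite e4 ltNge (node_le i.+1).
Qed.
End Nodes.

Section Partition.
Context {R : realType}.
Variable node : nat -> R.
Hypothesis node_ltS : forall i, node i < node i.+1.

Lemma node_homo : {homo node : i j / (i <= j)%N >-> i <= j}.
Proof. by apply: homo_leq => [x|y x z|i]; [exact: lexx|exact: le_trans|exact: ltW]. Qed.

Lemma node_locate t : node 0%N <= t -> (exists i, t < node i) ->
  exists i, node i <= t < node i.+1.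
Proof.
move=> t0 [m]; elim: m => [|m IH tm]; first by rewrite ltNge t0.
by have [mt|] := leP (node m) t; [exists m; rewrite mt tm|exact: IH].
Qed.

Lemma partial_averageE n (T : set R) (X : R -> 'rV[R]_n -> 'rV[R]_n) i t x :
  node i <= t < node i.+1 -> partial_average T node X t x = average T node X i x.
Proof.
move=> it; rewrite /partial_average; congr (average T node X _ x).
have /(xgetPex 0%N) /= : exists j, [set j | node j <= t < node j.+1] j by exists i.
set k := xget _ _ => kt.
have aux j l : node j <= t < node j.+1 -> node l <= t < node l.+1 -> (j <= l)%N.
  move=> /andP[jt _] /andP[_ tl]; rewrite leqNgt; apply/negP => lj.
  by have := lt_le_trans tl (node_homo lj); rewrite ltNge jt.
by apply/eqP; rewrite eqn_leq !aux.
Qed.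
End Partition.

(** * Averages over the periods *)

(** The averages enter as [u] and [w] through equations: comparing two of them
    by conversion would unfold the choice of the antiderivative. *)
Lemma norm_div_sub (R : realType) (V : normedModType R) (h c : R) (u w a b : V) :
  0 < h -> h *: u = a -> h *: w = b -> `|a - b| <= c * h -> `|u - w| <= c.
Proof.
by move=> h0 <- <-; rewrite -scalerBr normrZ gtr0_norm// mulrC ler_pM2r.
Qed.

Section Average.
Context {R : realType} {n : nat}.
Variables (T : set R) (node : nat -> R) (D : set 'rV[R]_n) (X : R -> 'rV[R]_n -> 'rV[R]_n).
Variables (M lambda : R).
Hypotheses (cT : closed T) (ubT : unbounded_above T).
Hypotheses (node_ltS : forall i, node i < node i.+1) (Tnode : forall i, T (node i)).
Hypotheses (M0 : 0 <= M) (lambda0 : 0 <= lambda).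
Hypothesis Xrd : forall x, D x -> rd_continuous T T (X ^~ x).
Hypothesis XM : forall t x, T t -> D x -> `|X t x| <= M.
Hypothesis Xlip : forall t x1 x2, T t -> D x1 -> D x2 ->
     `|X t x1 - X t x2| <= lambda * `|x1 - x2|.

(** The antiderivative that the delta integral selects. *)
Definition integral_of (x : 'rV[R]_n) : R -> 'rV[R]_n :=
  xget (fun=> 0) [set F | antiderivative T (X ^~ x) F].

Lemma integral_ofP x : D x -> antiderivative T (X ^~ x) (integral_of x).
Proof.
move=> Dx; apply: (xgetPex (fun=> 0) (P := [set F | antiderivative T (X ^~ x) F])).
by apply: (antiderivative_exists cT ubT (M := M)) (Xrd Dx) => t Tt; exact: XM.
Qed.

Lemma averageE i x :
  (node i.+1 - node i) *: average T node X i x =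
  integral_of x (node i.+1) - integral_of x (node i).
Proof. by rewrite /average scalerA divff ?scale1r// subr_eq0 gt_eqF. Qed.

Let gap0 i : 0 < node i.+1 - node i. Proof. by rewrite subr_gt0. Qed.

Lemma average_bound i x : D x -> `|average T node X i x| <= M.
Proof.
move=> Dx; rewrite -(ler_pM2r (gap0 i)) mulrC -[X in X * _]gtr0_norm// -normrZ averageE.
apply: antiderivative_increment (integral_ofP Dx) _ _ _ _ _ => //; first exact: ltW.
by move=> t Tt; exact: XM.
Qed.

Lemma average_lipschitz i x y : D x -> D y ->
  `|average T node X i x - average T node X i y| <= lambda * `|x - y|.
Proof.
move=> Dx Dy.
have dif : antiderivative T (fun t => X t x - X t y) (integral_of x \- integral_of y).
  by move=> t kt; apply: delta_deriveB; exact: integral_ofP.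
apply: (norm_div_sub (gap0 i) (averageE i x) (averageE i y)).
have -> : integral_of x (node i.+1) - integral_of x (node i) -
    (integral_of y (node i.+1) - integral_of y (node i)) =
    (integral_of x \- integral_of y) (node i.+1) - (integral_of x \- integral_of y) (node i).
  by rewrite /= !opprD !opprK addrACA.
apply: antiderivative_increment dif _ _ _ _ _ => //; first exact: ltW.
  by rewrite mulr_ge0.
by move=> t Tt; exact: Xlip.
Qed.
End Average.

(** * One period *)

Section Period.
Context {R : realType} {n : nat}.
Variables (T : set R) (D : set 'rV[R]_n) (X : R -> 'rV[R]_n -> 'rV[R]_n).
Variables (M lambda K eps : R).
Hypotheses (cT : closed T) (ubT : unbounded_above T).
Hypotheses (M0 : 0 <= M) (lambda0 : 0 <= lambda) (eps0 : 0 <= eps).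
Hypothesis XM : forall t x, T t -> D x -> `|X t x| <= M.
Hypothesis Xlip : forall t x1 x2, T t -> D x1 -> D x2 ->
     `|X t x1 - X t x2| <= lambda * `|x1 - x2|.

(** The integral from [a] of the frozen field minus its mean [A]: the first-order
    term of the near-identity change of variables of averaging theory. *)
Definition corrector (F : R -> 'rV[R]_n) (A : 'rV[R]_n) (a : R) : R -> 'rV[R]_n :=
  fun t => (F t - F a) - (t - a) *: A.

Lemma corrector_bound F A x a t : D x -> T a -> T t -> a <= t -> t - a <= K ->
  antiderivative T (X ^~ x) F -> `|A| <= M -> `|corrector F A a t| <= 2 * M * K.
Proof.
move=> Dx Ta Tt at_ taK FX AM; have ta : 0 <= t - a by rewrite subr_ge0.
have h : `|F t - F a| <= M * (t - a).
  by apply: (antiderivative_increment cT ubT FX) => // s Ts; exact: XM.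
apply: le_trans (ler_normB _ _) _; rewrite normrZ ger0_norm//.
have h2 : (t - a) * `|A| <= (t - a) * M by exact: ler_wpM2l.
have h3 : M * (t - a) <= M * K by exact: ler_wpM2l.
by move: h h2 h3; rewrite [_ * M]mulrC; lra.
Qed.

(** The derivative of [y - xi] is only of order [eps]. Subtracting [eps] times the
    corrector, whose derivative is the oscillating part of the field frozen at
    [xi a], leaves the differences of [X] and of [Abar] between the points [y s],
    [xi s] and [xi a]. Their Lipschitz bounds involve [y - xi], that is, the
    corrected difference up to [2 * M * K * eps], and twice the drift of [xi],
    at most [M * K * eps]; whence the constant [4 * M * K * eps]. *)
Lemma period_estimate (a b t : R) (Abar : 'rV[R]_n -> 'rV[R]_n) (F y xi : R -> 'rV[R]_n) :
  T a -> T t -> a <= t <= b -> b - a <= K -> D (xi a) ->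
  (forall x, D x -> `|Abar x| <= M) ->
  (forall x1 x2, D x1 -> D x2 -> `|Abar x1 - Abar x2| <= lambda * `|x1 - x2|) ->
  antiderivative T (X ^~ (xi a)) F ->
  (forall s, T s -> a <= s < t -> D (y s) /\
     is_delta_derive T (T `&` `[a, t]) y s (eps *: X s (y s))) ->
  (forall s, T s -> a <= s < t -> D (xi s) /\
     is_delta_derive T (T `&` `[a, t]) xi s (eps *: Abar (xi s))) ->
  y s @[s --> within (T `&` `[a, t]) (nbhs t)] --> y t ->
  (forall s, T s -> a <= s <= t ->
     xi u @[u --> within (T `&` `[a, s]) (nbhs s)] --> xi s) ->
  `|y t - xi t - eps *: corrector F (Abar (xi a)) a t| <=
    (`|y a - xi a| + eps * lambda * (4 * M * K * eps) * (t - a)) *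
    expR (eps * lambda * (t - a)).
Proof.
move=> Ta Tt /andP[at_ tb] baK Dxa AM Alip FX ysol xisol yc xic.
have K0 : 0 <= K by apply: le_trans baK; rewrite subr_ge0 (le_trans at_).
set W := corrector F (Abar (xi a)) a.
have Wbound s : T s -> a <= s <= t -> `|W s| <= 2 * M * K.
  move=> Ts /andP[as_ st]; apply: (corrector_bound Dxa) => //; last exact: AM.
  by move: st tb baK; lra.
have xi_drift s : T s -> a <= s < t -> `|xi s - xi a| <= eps * M * K.
  move=> Ts /andP[as_ st].
  apply: (@le_trans _ _ (eps * M * (s - a))); last first.
    by apply: ler_wpM2l; rewrite ?mulr_ge0//; move: st tb baK; lra.
  have incl : (T `&` `[a, s]) `<=` (T `&` `[a, t]).
    by apply: itvS => //; exact: ltW.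
  apply: (@delta_mean_value _ _ _ cT ubT _ _ _ xi (fun u => eps *: Abar (xi u))) => //.
  - by rewrite mulr_ge0.
  - move=> u Tu /andP[au us]; apply: delta_deriveS incl _.
    by apply: (xisol u Tu _).2; rewrite au (lt_trans us).
  - move=> u Tu /andP[au us]; rewrite normrZ ger0_norm//; apply: ler_wpM2l => //.
    by apply: AM; apply: (xisol u Tu _).1; rewrite au (lt_trans us).
  - by apply: xic => //; rewrite as_ ltW.
have dW s : T s -> is_delta_derive T (T `&` `[a, t]) W s (X s (xi a) - Abar (xi a)).
  move=> Ts.
  have FXs : is_delta_derive T (T `&` `[a, t]) F s (X s (xi a)).
    have incl : (T `&` `[a, t]) `<=` T by move=> u [].
    by apply: (delta_deriveS incl); apply: FX; rewrite kappaE.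
  exact: delta_deriveB (delta_derive_subc (F a) FXs)
    (delta_derive_line T (T `&` `[a, t]) a (Abar (xi a)) s).
pose v := (y \- xi) \- (fun s => eps *: W s).
pose d s := (eps *: X s (y s) - eps *: Abar (xi s)) - eps *: (X s (xi a) - Abar (xi a)).
have Wa : W a = 0 by rewrite /W /corrector !subrr scale0r subr0.
have va : `|v a| <= `|y a - xi a| by rewrite /v /= Wa scaler0 subr0.
have -> : y t - xi t - eps *: W t = v t by [].
have el0 : 0 <= eps * lambda by rewrite mulr_ge0.
have W_cvg : W s @[s --> within (T `&` `[a, t]) (nbhs t)] --> W t.
  by apply: delta_derive_cvg (dW t Tt); split => //=; rewrite in_itv /= at_ lexx.
apply: (@delta_gronwall _ _ _ cT ubT a t _ _ _ v d) => //.
- by rewrite !mulr_ge0.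
- move=> s Ts ast; apply: delta_deriveB; last by apply: delta_deriveZ; exact: dW.
  by apply: delta_deriveB; [exact: (ysol s Ts ast).2|exact: (xisol s Ts ast).2].
- move=> s Ts ast.
  have [[Dy _] [Dxi _]] := (ysol s Ts ast, xisol s Ts ast).
  have -> : d s = eps *: ((X s (y s) - X s (xi a)) - (Abar (xi s) - Abar (xi a))).
    by rewrite /d -!scalerBr !opprD !opprK addrACA.
  rewrite normrZ ger0_norm// -[eps * lambda * _]mulrA -[eps * lambda * _]mulrA -mulrDr.
  apply: ler_wpM2l => //; rewrite -mulrDr.
  have e1 : `|X s (y s) - X s (xi a)| <= lambda * `|y s - xi a| by exact: Xlip.
  have e2 : `|Abar (xi s) - Abar (xi a)| <= lambda * `|xi s - xi a| by exact: Alip.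
  apply: le_trans (ler_normB _ _) _; apply: le_trans (lerD e1 e2) _.
  rewrite -mulrDr; apply: ler_wpM2l => //.
  have e3 := xi_drift _ Ts ast.
  have e4 : `|y s - xi a| <= `|v s| + `|eps *: W s| + `|xi s - xi a|.
    have -> : y s - xi a = v s + eps *: W s + (xi s - xi a).
      by rewrite /v /= subrK addrA subrK.
    by apply: le_trans (ler_normD _ _) _; rewrite lerD2r ler_normD.
  have e5 : `|eps *: W s| <= eps * (2 * M * K).
    rewrite normrZ ger0_norm//; apply: ler_wpM2l => //; apply: Wbound => //.
    by case/andP: ast => -> /ltW.
  by move: e3 e4 e5; lra.
- apply: cvgB; last by apply: cvgZr.
  by apply: cvgB => //; apply: xic => //; rewrite at_ lexx.
Qed.
End Period.

(** * Error estimate over all periods *)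

Lemma solution_cvg {R : realType} {n : nat} (T : set R) (D : set 'rV[R]_n)
    (F : R -> 'rV[R]_n -> 'rV[R]_n) t1 x1 c y s a :
  T s -> t1 <= a -> a <= s -> s < c ->
  is_solution T D F t1 x1 (T `&` `[t1, c[) y ->
  y u @[u --> within (T `&` `[a, s]) (nbhs s)] --> y s.
Proof.
move=> Ts ta as_ sc [_ /(_ s)] [|_ yd].
  by split => //=; rewrite in_itv /= (le_trans ta).
apply: cvg_withinS (itvyS ta) (delta_derive_cvg _ yd).
by split => //=; rewrite in_itv /= andbT (le_trans ta).
Qed.

Section Apriori.
Context {R : realType} {n : nat}.
Variables (T : set R) (node : nat -> R) (D : set 'rV[R]_n) (X : R -> 'rV[R]_n -> 'rV[R]_n).
Variables (M lambda K eps : R) (x0 : 'rV[R]_n) (xi : R -> 'rV[R]_n).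
Hypotheses (cT : closed T) (ubT : unbounded_above T).
Hypotheses (node_ltS : forall i, node i < node i.+1) (Tnode : forall i, T (node i)).
Hypothesis node_unbounded : forall t, exists i, t < node i.
Hypothesis node_gap : forall i, node i.+1 - node i <= K.
Hypotheses (M0 : 0 <= M) (lambda0 : 0 <= lambda) (eps0 : 0 <= eps).
Hypothesis Xrd : forall x, D x -> rd_continuous T T (X ^~ x).
Hypothesis XM : forall t x, T t -> D x -> `|X t x| <= M.
Hypothesis Xlip : forall t x1 x2, T t -> D x1 -> D x2 ->
     `|X t x1 - X t x2| <= lambda * `|x1 - x2|.
Hypothesis xi_sol : is_piecewise_solution T D node
  (fun t x => eps *: partial_average T node X t x) x0 xi.

Lemma xi_cvg a t : T t -> node 0%N <= a -> a <= t ->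
  xi s @[s --> within (T `&` `[a, t]) (nbhs t)] --> xi t.
Proof.
move=> Tt a0 at_; case: xi_sol => _ /subspace_continuousP xc _.
apply: cvg_withinS (itvyS a0) (xc t _).
by split => //=; rewrite in_itv /= andbT (le_trans a0).
Qed.

Lemma xi_period i s : T s -> node i <= s < node i.+1 -> D (xi s) /\
  is_delta_derive T (T `&` `[node i, +oo[) xi s (eps *: average T node X i (xi s)).
Proof.
move=> Ts is_; case: xi_sol => _ _ /(_ i) [_ /(_ s)].
rewrite (partial_averageE node_ltS T X (xi s) is_).
by apply; split; [rewrite kappaE|rewrite /= in_itv].
Qed.

Let rate := eps * lambda * (4 * M * K * eps).

(** The corrector vanishes at the nodes, so the bound of one period is the initial
    condition of the next; the uncorrected difference costs only the last
    corrector. The solution [y] is needed just before [t], with continuity at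
    [t], because a solution under construction is known no further. *)
Lemma averaging_error y t : T t -> node 0%N <= t ->
  is_solution T D (fun t x => eps *: X t x) (node 0%N) x0 (T `&` `[node 0%N, t[) y ->
  y s @[s --> within (T `&` `[node 0%N, t]) (nbhs t)] --> y t ->
  `|y t - xi t| <= eps * (2 * M * K) +
    rate * (t - node 0%N) * expR (eps * lambda * (t - node 0%N)).
Proof.
move=> Tt t0t ysol yc.
have K0 : 0 <= K by apply: le_trans (node_gap 0%N); rewrite subr_ge0 ltW.
have rate0 : 0 <= rate by rewrite /rate !mulr_ge0.
have el0 : 0 <= eps * lambda by rewrite mulr_ge0.
have n0 i : node 0%N <= node i by exact: node_homo.
have Dxi i : D (xi (node i)).
  by apply: (@xi_period i _ (Tnode i) _).1; rewrite lexx node_ltS.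
pose F i := integral_of T X (xi (node i)).
have FP i : antiderivative T (X ^~ (xi (node i))) (F i).
  exact: (integral_ofP cT ubT Xrd XM (Dxi i)).
pose W i := corrector (F i) (average T node X i (xi (node i))) (node i).
pose y_bound s := rate * (s - node 0%N) * expR (eps * lambda * (s - node 0%N)).
have avM i x : D x -> `|average T node X i x| <= M.
  exact: (average_bound cT ubT node_ltS Tnode M0 Xrd XM).
have avL i x1 x2 : D x1 -> D x2 ->
    `|average T node X i x1 - average T node X i x2| <= lambda * `|x1 - x2|.
  exact: (average_lipschitz cT ubT node_ltS Tnode lambda0 Xrd XM Xlip).
have step i s : T s -> node i <= s <= node i.+1 -> s <= t ->
    `|y s - xi s - eps *: W i s| <=
    (`|y (node i) - xi (node i)| + rate * (s - node i)) * expR (eps * lambda * (s - node i)).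
  move=> Ts is_ st; have [i_s s_i] := andP is_.
  apply: (period_estimate cT ubT M0 lambda0 eps0 XM Xlip (Tnode i) Ts is_ (node_gap i) (Dxi i)
    (avM i) (avL i) (FP i)).
  - move=> u Tu /andP[iu us]; case: ysol => _ /(_ u) [|Dy yd].
      by split => //=; rewrite in_itv /= (le_trans (n0 i) iu) (lt_le_trans us).
    by split => //; apply: delta_deriveS yd; exact: itvyS.
  - move=> u Tu /andP[iu us].
    have [|Dx xd] := @xi_period i u Tu; first by rewrite iu (lt_le_trans us).
    by split => //; apply: delta_deriveS xd; exact: itvyS.
  - move: st; rewrite le_eqVlt => /predU1P[-> |st].
      by apply: cvg_withinS yc; exact: itvS.
    exact: (solution_cvg Ts (n0 i) i_s st ysol).
  - by move=> u Tu /andP[iu us]; exact: xi_cvg.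
have start i : node i <= t -> `|y (node i) - xi (node i)| <= y_bound (node i) ->
    forall s, T s -> node i <= s <= node i.+1 -> s <= t ->
    `|y s - xi s - eps *: W i s| <= y_bound s.
  move=> it h s Ts is_ st; apply: le_trans (step i s Ts is_ st) _.
  have [i_s s_i] := andP is_.
  have -> : y_bound s = rate * (s - node 0%N) * expR (eps * lambda * (node i - node 0%N)) *
      expR (eps * lambda * (s - node i)).
    by rewrite -mulrA -expRD /y_bound; congr (_ * expR _); ring.
  rewrite ler_wpM2r ?expR_ge0//.
  apply: (@le_trans _ _ (y_bound (node i) +
      rate * (s - node i) * expR (eps * lambda * (node i - node 0%N)))).
    rewrite lerD// ler_peMr ?mulr_ge0 ?subr_ge0//.
    by rewrite -(expR0 R) ler_expR mulr_ge0// subr_ge0.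
  by rewrite le_eqVlt; apply/predU1P; left; rewrite /y_bound; ring.
have nodes i : node i <= t -> `|y (node i) - xi (node i)| <= y_bound (node i).
  elim: i => [_|i IH it].
    case: ysol => -> _; case: xi_sol => -> _ _.
    by rewrite subrr normr0 /y_bound subrr mulr0 mul0r.
  have it' : node i <= t by apply: le_trans it; exact: ltW.
  have := start i it' (IH it') _ (Tnode i.+1) _ it.
  rewrite lexx ltW// => /(_ isT).
  suff -> : W i (node i.+1) = 0 by rewrite scaler0 subr0.
  rewrite /W /corrector (averageE T X node_ltS i (xi (node i))) -/(F i).
  exact: subrr.
have [i it] := node_locate t0t (node_unbounded t).
have [i_t t_i] := andP it.
have itle : node i <= t <= node i.+1 by rewrite i_t ltW.
have vt := start i i_t (nodes i i_t) t Tt itle (lexx t).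
have Wt : `|W i t| <= 2 * M * K.
  apply: (corrector_bound cT ubT M0 XM (Dxi i) (Tnode i) Tt i_t _ (FP i) (avM i _ (Dxi i))).
  by apply: le_trans (node_gap i); rewrite lerD2r ltW.
have -> : y t - xi t = eps *: W i t + (y t - xi t - eps *: W i t) by rewrite [RHS]addrC subrK.
apply: le_trans (ler_normD _ _) _; apply: lerD => //.
by rewrite normrZ ger0_norm//; apply: ler_wpM2l.
Qed.
End Apriori.

(** * Continuation of solutions *)

Section Continuation.
Context {R : realType} {n : nat}.
Variables (T : set R) (D : set 'rV[R]_n) (G : R -> 'rV[R]_n -> 'rV[R]_n).
Variables (N lambda t0 : R) (x0 : 'rV[R]_n).
Hypotheses (cT : closed T) (ubT : unbounded_above T) (Tt0 : T t0).
Hypotheses (N0 : 0 <= N) (lambda0 : 0 <= lambda).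
Hypothesis GN : forall t x, T t -> D x -> `|G t x| <= N.
Hypothesis Glip : forall t x1 x2, T t -> D x1 -> D x2 ->
     `|G t x1 - G t x2| <= lambda * `|x1 - x2|.
Hypothesis Grd : forall t x, T t -> D x -> right_dense T t ->
  G s x @[s --> within T (nbhs t)] --> G t x.
Hypothesis Glocal : forall t1 x1, T t1 -> interior D x1 ->
  exists2 c, t1 < c & exists x, is_solution T D G t1 x1 (T `&` `[t1, c[) x.

(** Continuity at the endpoint is required because the equation does not
    constrain [y t] when [t] is left-dense. *)
Definition solution_upto t (y : R -> 'rV[R]_n) :=
  is_solution T D G t0 x0 (T `&` `[t0, t[) y /\
  y s @[s --> within (T `&` `[t0, t]) (nbhs t)] --> y t.

Lemma solution_upto_restrict c t y : T t -> t0 <= t -> t < c ->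
  is_solution T D G t0 x0 (T `&` `[t0, c[) y -> solution_upto t y.
Proof.
move=> Tt t0t tc ysol; split; last exact: (solution_cvg Tt (lexx t0) t0t tc ysol).
case: ysol => y0 ysol; split => // s [Ts /=]; rewrite in_itv /= => /andP[t0s st].
by apply: ysol; split => //=; rewrite in_itv /= t0s (lt_trans st).
Qed.

Lemma solution_upto_unique t y z : T t -> t0 <= t ->
  solution_upto t y -> solution_upto t z -> y t = z t.
Proof.
move=> Tt t0t [[y0 ys] yc] [[z0 zs] zc].
apply/eqP; rewrite -subr_eq0 -normr_le0.
have inI s : T s -> t0 <= s < t -> (T `&` `[t0, t[) s.
  by move=> Ts h; split => //=; rewrite in_itv.
have := @delta_gronwall _ _ _ cT ubT t0 t lambda 0 0 (y \- z)
  (fun s => G s (y s) - G s (z s)) Tt0 Tt t0t lambda0 (lexx 0).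
rewrite mul0r addr0 mul0r; apply.
- move=> s Ts st; apply: delta_deriveB.
    exact: delta_deriveS (itvyS (lexx t0)) (ys s (inI s Ts st)).2.
  exact: delta_deriveS (itvyS (lexx t0)) (zs s (inI s Ts st)).2.
- move=> s Ts st; rewrite addr0; apply: Glip => //.
    exact: (ys s (inI s Ts st)).1.
  exact: (zs s (inI s Ts st)).1.
- exact: cvgB.
- by rewrite /= y0 z0 subrr normr0.
Qed.

(** For [s < t] in [T] neither [sigma T s] nor the points near [s] exceed [t], so
    a change after [t] leaves the derivative at [s] as it is. *)
Lemma delta_derive_before t s (y z : R -> 'rV[R]_n) d E : T t -> s < t ->
  (forall u, T u -> u <= t -> z u = y u) -> E `<=` T -> T s ->
  is_delta_derive T E y s d -> is_delta_derive T E z s d.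
Proof.
move=> Tt st zy ET Ts; apply: delta_derive_local.
  have d0 : 0 < t - s by rewrite subr_gt0.
  apply: filterS (near_dist s d0) => u su Eu; split => //; apply: zy; first exact: ET.
  by move: su; rewrite ltr_distlC; lra.
by apply: zy; [exact: sigma_in|exact: sigma_le].
Qed.

(** The equation at a right-scattered point prescribes the value at the jump; it
    is the left-continuity at [t] that makes the derivative there two-sided. *)
Lemma extend_right_scattered t y : T t -> t0 <= t -> t < sigma T t -> D (y t) ->
  solution_upto t y ->
  exists z, is_solution T D G t0 x0 (T `&` `[t0, sigma T t[) z /\ solution_upto (sigma T t) z.
Proof.
move=> Tt t0t tst Dyt [[y0 ys] yc].
pose z s := if s <= t then y s else y t + (sigma T t - t) *: G t (y t).
have zy s : s <= t -> z s = y s by rewrite /z => ->.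
have zs : z (sigma T t) = y t + (sigma T t - t) *: G t (y t).
  by rewrite /z leNgt tst.
have m0 : 0 < sigma T t - t by rewrite subr_gt0.
have zsol : is_solution T D G t0 x0 (T `&` `[t0, sigma T t[) z.
  split; first by rewrite zy.
  move=> s [Ts /=]; rewrite in_itv /= => /andP[t0s sst].
  have := lt_sigma_le ubT Ts sst; rewrite le_eqVlt => /predU1P[->|st].
    rewrite zy//; split => // e e0.
    have /cvgrPdist_le yc' := yc.
    have e1 : 0 < e * (sigma T t - t) / 2 by rewrite divr_gt0// mulr_gt0.
    have g1 : 0 < `|G t (y t)| + 1 by rewrite ltr_wpDl.
    have d0 : 0 < Num.min (sigma T t - t) (e * (sigma T t - t) / 2 / (`|G t (y t)| + 1)).
      by rewrite lt_min m0 divr_gt0.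
    apply: (filterS2 _ _ (near_dist t d0) (yc' _ e1)) => u.
    rewrite lt_min => /andP[tu1 tu2] yu [Tu /=]; rewrite in_itv /= andbT => t0u.
    have ut : u <= t.
      by apply: (lt_sigma_le ubT Tu); move: tu1; rewrite ltr_distlC; lra.
    have yut : `|y t - y u| <= e * (sigma T t - t) / 2.
      by apply: yu; split => //=; rewrite in_itv /= t0u ut.
    rewrite zs (zy u ut).
    have -> : y t + (sigma T t - t) *: G t (y t) - y u - (sigma T t - u) *: G t (y t) =
        (y t - y u) - (t - u) *: G t (y t).
      have -> : sigma T t - u = (sigma T t - t) + (t - u) by ring.
      by rewrite (addrAC (y t)) [(_ - t + _) *: _]scalerDl opprD addrA addrK.
    apply: le_trans (ler_normB _ _) _; rewrite normrZ.
    have h : `|t - u| * `|G t (y t)| <= e * (sigma T t - t) / 2.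
      move: tu2; rewrite ltr_pdivlMr// => /ltW; apply: le_trans.
      by apply: ler_wpM2l; rewrite ?lerDl.
    have h2 : e * (sigma T t - t) <= e * `|sigma T t - u|.
      by apply: ler_wpM2l; [exact: ltW|rewrite ger0_norm; move: ut m0; lra].
    by move: h h2 yut; lra.
  rewrite zy ?(ltW st)//; have [|Dy yd] := ys s.
    by split => //=; rewrite in_itv /= t0s.
  have ET : (T `&` `[t0, +oo[) `<=` T by move=> u [].
  by split => //; exact: (delta_derive_before Tt st (fun u _ => zy u) ET Ts yd).
exists z; split => //; split => //.
apply/cvgrPdist_le => e e0; rewrite near_withinE.
apply: filterS (near_dist (sigma T t) m0) => s sst [Ts /=]; rewrite in_itv /= => /andP[_ ss].
have -> : s = sigma T t.
  apply/le_anti; rewrite ss /=; apply: sigma_le => //.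
  by move: sst; rewrite ltr_distlC; lra.
by rewrite subrr normr0 ltW.
Qed.

(** The field along the solution is continuous at a right-dense point, so the mean
    value inequality, applied after subtracting the linear function of slope
    [G t (y t)], gives the derivative from the left. *)
Lemma left_derivative t y : T t -> t0 <= t -> sigma T t = t -> D (y t) -> solution_upto t y ->
  forall e, 0 < e -> \forall u \near t, T u -> t0 <= u <= t ->
    `|y t - y u - (t - u) *: G t (y t)| <= e * (t - u).
Proof.
move=> Tt t0t tE Dyt [[y0 ys] yc] e e0.
have /cvgrPdist_le Gc := Grd Tt Dyt (sigma_right_dense ubT tE).
have /cvgrPdist_le yc' := yc.
have l1 : 0 < lambda + 1 by rewrite ltr_wpDl.
have e1 : 0 < e / 2 / (lambda + 1) by rewrite !divr_gt0.
have e2 : 0 < e / 2 by rewrite divr_gt0.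
have [dl dl0 near_t] : exists2 dl, 0 < dl & forall s, `|t - s| < dl -> T s -> t0 <= s <= t ->
    `|G s (y s) - G t (y t)| <= e \/ ~ D (y s).
  have Gn := Gc _ e2; have yn := yc' _ e1; rewrite !near_withinE in Gn yn.
  have /nbhs_ballP[dl /= dl0 hd] : \forall s \near t, T s -> t0 <= s <= t ->
      `|G t (y t) - G s (y t)| <= e / 2 /\ `|y t - y s| <= e / 2 / (lambda + 1).
    apply: (filterS2 _ _ Gn yn) => s h1 h2 Ts t0s.
    by split; [exact: h1|apply: h2; split => //=; rewrite in_itv].
  exists dl => // s sd Ts t0s; have [Ds|] := pselect (D (y s)); [left|by right].
  have [h1 h2] := hd s sd Ts t0s.
  have h3 := Glip Ts Dyt Ds.
  have h4 : lambda * `|y t - y s| <= e / 2.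
    apply: (@le_trans _ _ ((lambda + 1) * `|y t - y s|)).
      by apply: ler_wpM2r; rewrite ?lerDl.
    by rewrite mulrC -ler_pdivlMr.
  have -> : G s (y s) - G t (y t) = - ((G t (y t) - G s (y t)) + (G s (y t) - G s (y s))).
    by rewrite addrA subrK opprB.
  rewrite normrN [leRHS]splitr; apply: le_trans (ler_normD _ _) _.
  by apply: lerD => //; apply: le_trans h3 h4.
apply: filterS (near_dist t dl0) => u tu Tu /andP[t0u ut].
have incl : (T `&` `[u, t]) `<=` (T `&` `[t0, +oo[) by exact: itvyS.
pose v := (fun s => y s - (s - t) *: G t (y t)).
have -> : y t - y u - (t - u) *: G t (y t) = v t - v u.
  rewrite /v subrr scale0r subr0 opprB.
  by rewrite -[u - t]opprB scaleNr addrA addrAC.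
apply: (@delta_mean_value _ _ _ cT ubT u t e v (fun s => G s (y s) - G t (y t))) => //.
- exact: ltW.
- move=> s Ts /andP[us st]; apply: delta_deriveB (delta_derive_line _ _ _ _ _).
  apply: (delta_deriveS incl); apply: (ys s _).2.
  by split => //=; rewrite in_itv /= (le_trans t0u).
- move=> s Ts /andP[us st].
  have t0s : t0 <= s := le_trans t0u us.
  have [| | |//|] := near_t s.
  + by move: tu; rewrite !ltr_distlC; move: us st dl0; lra.
  + by [].
  + by rewrite t0s ltW.
  + by case; apply: (ys s _).1; split => //=; rewrite in_itv /= t0s.
- apply: cvgB; first by apply: cvg_withinS yc; exact: itvS.
  have Et : (T `&` `[u, t]) t by split => //=; rewrite in_itv /= ut lexx.
  exact: delta_derive_cvg Et (delta_derive_line _ _ _ _ _).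
Qed.

(** Local existence yields a solution forward of [t] with a derivative from the
    right only; gluing needs [left_derivative] at [t]. *)
Lemma extend_right_dense t y : T t -> t0 <= t -> sigma T t = t -> interior D (y t) ->
  solution_upto t y ->
  exists2 c, t < c & exists z, is_solution T D G t0 x0 (T `&` `[t0, c[) z.
Proof.
move=> Tt t0t tE Dyt ysol; have [c tc [w [wt ws]]] := Glocal Tt Dyt.
have Dy : D (y t) by exact: interior_subset Dyt.
exists c => //.
pose z s := if s <= t then y s else w s.
have zy s : s <= t -> z s = y s by rewrite /z => ->.
have zw s : t <= s -> z s = w s.
  by rewrite le_eqVlt => /predU1P[<-|ts]; [rewrite zy// wt|rewrite /z leNgt ts].
exists z; split; first by rewrite zy//; case: ysol => -[].
move=> s [Ts /=]; rewrite in_itv /= => /andP[t0s sc].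
have [st|ts|->] := ltgtP s t.
- have [[_ ys] _] := ysol.
  rewrite zy ?(ltW st)//; have [|Dys yd] := ys s.
    by split => //=; rewrite in_itv /= t0s.
  have ET : (T `&` `[t0, +oo[) `<=` T by move=> u [].
  by split => //; exact: (delta_derive_before Tt st (fun u _ => zy u) ET Ts yd).
- rewrite zw ?ltW//; have [|Dws wd] := ws s.
    by split => //=; rewrite in_itv /= ltW.
  split => //; apply: delta_derive_local wd.
    have d0 : 0 < s - t by rewrite subr_gt0.
    apply: filterS (near_dist s d0) => u su [Tu _].
    have tu : t <= u by move: su; rewrite ltr_distlC; lra.
    by split; [split => //=; rewrite in_itv /= tu|exact: zw].
  by apply: zw; rewrite (le_trans (ltW ts))// sigma_ge.
- rewrite zy// ; split => // e e0.
  have [|_ /(_ e e0) wd] := ws t; first by split => //=; rewrite in_itv /= lexx.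
  have yd := left_derivative Tt t0t tE Dy ysol e0.
  apply: (filterS2 _ _ wd yd) => u hw hy [Tu /=]; rewrite in_itv /= andbT => t0u.
  rewrite tE in hw *; have [ut|/ltW tu] := leP u t.
    by rewrite !zy// [`|t - u|]ger0_norm ?subr_ge0//; apply: hy; rewrite // t0u.
  rewrite !zw// -wt; apply: hw; split => //=; rewrite in_itv /= tu//.
Qed.

(** Uniqueness glues the solutions on shorter intervals into one, which is
    Lipschitz because the field is bounded, hence has a limit at [t]. *)
Lemma extend_left_dense t : T t -> t0 < t ->
  (forall e, 0 < e -> exists2 s, T s & t - e < s < t) ->
  (forall s, T s -> t0 <= s < t -> exists y, solution_upto s y) ->
  exists z, solution_upto t z.
Proof.
move=> Tt t0t tl ex.
have /choice[Y HY] s : exists y, T s -> t0 <= s < t -> solution_upto s y.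
  have [[Ts st]|h] := pselect (T s /\ t0 <= s < t).
    by have [y Hy] := ex s Ts st; exists y.
  by exists (cst x0) => Ts st; case: h.
have agree s s' : T s -> T s' -> t0 <= s -> s <= s' -> s' < t -> Y s' s = Y s s.
  move=> Ts Ts' t0s; rewrite le_eqVlt => /predU1P[-> //|ss'] s't.
  have [sol' _] : solution_upto s' (Y s') by apply: HY; rewrite // (le_trans t0s (ltW ss')).
  apply: (solution_upto_unique Ts t0s) (solution_upto_restrict Ts t0s ss' sol') _.
  by apply: HY; rewrite // t0s (lt_trans ss').
(* the value [l] at [t] is left open until the limit is known *)
pose z (l : 'rV[R]_n) s := if s < t then Y s s else l.
have zY l s : s < t -> z l s = Y s s by rewrite /z => ->.
have later s : s < t -> exists2 s', T s' & s < s' < t.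
  move=> st; have d0 : 0 < t - s by rewrite subr_gt0.
  by have [s' Ts'] := tl _ d0; rewrite subKr => ss'; exists s'.
have zsol l : is_solution T D G t0 x0 (T `&` `[t0, t[) (z l).
  split.
    rewrite zY//; have [[-> _] _] // : solution_upto t0 (Y t0) by apply: HY; rewrite // lexx.
  move=> s [Ts /=]; rewrite in_itv /= => /andP[t0s st].
  have [s' Ts' /andP[ss' s't]] := later s st.
  have [[_ sol'] _] : solution_upto s' (Y s') by apply: HY; rewrite // (le_trans t0s (ltW ss')).
  have [|Dy yd] := sol' s; first by split => //=; rewrite in_itv /= t0s.
  have zs u : T u -> t0 <= u -> u <= s' -> z l u = Y s' u.
    by move=> Tu t0u us'; rewrite zY ?(le_lt_trans us')// -(agree u s').
  rewrite zs ?(ltW ss')//; split => //.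
  apply: delta_derive_local yd; last first.
    by apply: zs; [exact: sigma_in|rewrite (le_trans t0s)// sigma_ge|exact: sigma_le].
  have d0 : 0 < s' - s by rewrite subr_gt0.
  apply: filterS (near_dist s d0) => u su [Tu /=]; rewrite in_itv /= andbT => t0u.
  split; first by split => //=; rewrite in_itv /= t0u.
  by apply: zs => //; move: su; rewrite ltr_distlC; lra.
have zlip s u : T s -> T u -> t0 <= s -> s <= u -> u < t -> `|z 0 u - z 0 s| <= N * (u - s).
  move=> Ts Tu t0s su ut.
  have [_ zs] := zsol 0.
  apply: (@delta_mean_value _ _ _ cT ubT s u N (z 0) (fun v => G v (z 0 v))) => //.
  - move=> v Tv /andP[sv vu].
    apply: (@delta_deriveS _ _ _ (T `&` `[t0, +oo[)); first exact: itvyS.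
    by apply: (zs v _).2; split => //=; rewrite in_itv /= (le_trans t0s) // (lt_trans vu).
  - move=> v Tv /andP[sv vu]; apply: GN => //.
    by apply: (zs v _).1; split => //=; rewrite in_itv /= (le_trans t0s) // (lt_trans vu).
  - exact: (solution_cvg Tu t0s su ut (zsol 0)).
have cl : closure (T `&` `[t0, t[) t.
  move=> B /nbhs_ballP[d /= d0 dB].
  have m0 : 0 < Num.min d (t - t0) by rewrite lt_min d0 subr_gt0.
  have [s Ts /andP[ts st]] := tl _ m0.
  have [h1 h2] : t - d < s /\ t0 < s.
    by move: ts; rewrite ltrBlDl -ltrBlDr lt_min => /andP[]; lra.
  exists s; split; first by split => //=; rewrite in_itv /= (ltW h2).
  by apply: dB; rewrite /ball /= ltr_distlC h1; move: st d0; lra.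
have PF : ProperFilter (within (T `&` `[t0, t[) (nbhs t)) by exact: within_nbhs_proper cl.
have : cvg (z 0 s @[s --> within (T `&` `[t0, t[) (nbhs t)]).
  apply/cauchy_cvgP; apply: cauchy_exP => e e0.
  have N1 : 0 < N + 1 by rewrite ltr_wpDl.
  have m0 : 0 < Num.min (e / (N + 1)) (t - t0) by rewrite lt_min divr_gt0// subr_gt0.
  have [s Ts /andP[ts st]] := tl _ m0.
  have [h1 h2] : t - e / (N + 1) < s /\ t0 < s.
    by move: ts; rewrite ltrBlDl -ltrBlDr lt_min => /andP[]; lra.
  exists (z 0 s).
  have d0 : 0 < t - s by rewrite subr_gt0.
  suff : \forall u \near within (T `&` `[t0, t[) (nbhs t), ball (z 0 s) e (z 0 u) by [].
  rewrite near_withinE; apply: filterS (near_dist t d0) => u tu [Tu /=].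
  rewrite in_itv /= => /andP[t0u ut].
  have su : s <= u by move: tu; rewrite ltr_distlC; lra.
  rewrite -ball_normE /= distrC; apply: le_lt_trans (zlip s u Ts Tu (ltW h2) su ut) _.
  apply: (@le_lt_trans _ _ ((N + 1) * (u - s))).
    by apply: ler_wpM2r; rewrite ?subr_ge0// lerDl.
  by rewrite mulrC -ltr_pdivlMr//; move: h1 ut; lra.
move=> /cvg_ex[l zl]; exists (z l); split; first exact: zsol.
apply/cvgrPdist_le => e e0.
have /cvgrPdist_le /(_ _ e0) := zl; rewrite !near_withinE.
apply: filterS => u hu [Tu /=]; rewrite in_itv /= => /andP[t0u].
have zt : z l t = l by rewrite /z ltxx.
rewrite zt le_eqVlt => /predU1P[->|ut]; first by rewrite zt subrr normr0 ltW.
by rewrite zY// -(zY 0)//; apply: hu; split => //=; rewrite in_itv /= t0u.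
Qed.

(** Induction along [T] reaches the last point [m] of [T] up to [b]; one further
    extension passes [b], since [m] is either [b] itself or jumps beyond [b]. *)
Lemma solution_exists b : t0 <= b ->
  (forall t y, T t -> t0 <= t <= b -> solution_upto t y -> interior D (y t)) ->
  exists c x, b < c /\ is_solution T D G t0 x0 (T `&` `[t0, c[) x.
Proof.
move=> t0b stay.
have hS : has_sup (T `&` [set s | s <= b]) by split; [exists t0|exists b => s []].
pose m := sup (T `&` [set s | s <= b]).
have Tm : T m by apply: closed_sup => // s [].
have t0m : t0 <= m by apply: ub_le_sup; [case: hS|split].
have mb : m <= b by apply: ge_sup; [case: hS|move=> s []].
have all_upto : forall t, T t -> t0 <= t <= m -> exists y, solution_upto t y.
  apply: (timescale_induction cT ubT Tt0).
  - exists (cst x0); split; last exact: cvg_cst.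
    by split => // s [_ /=]; rewrite in_itv /= => /andP[/le_lt_trans h /h]; rewrite ltxx.
  - move=> t Tt /andP[t0t tm] tst [y Hy].
    have Dy : D (y t).
      by apply: interior_subset; apply: stay => //; rewrite t0t (le_trans (ltW tm)).
    by have [z [_ Hz]] := extend_right_scattered Tt t0t tst Dy Hy; exists z.
  - move=> t Tt /andP[t0t tm] tE [y Hy].
    have Dy : interior D (y t) by apply: stay => //; rewrite t0t (le_trans (ltW tm)).
    have [c tc [z Hz]] := extend_right_dense Tt t0t tE Dy Hy.
    exists c => // s Ts /andP[ts sc]; exists z.
    by apply: solution_upto_restrict sc Hz => //; rewrite (le_trans t0t) ?ltW.
  - by move=> t Tt /andP[t0t tm]; exact: extend_left_dense.
have [|y Hy] := all_upto m Tm; first by rewrite t0m lexx.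
have Dy : interior D (y m) by apply: stay => //; rewrite t0m.
have beyond s : T s -> m < s -> b < s.
  move=> Ts ms; rewrite ltNge; apply/negP => sb; move: ms; rewrite ltNge => /negP; apply.
  by apply: ub_le_sup; [case: hS|split].
have := sigma_ge ubT m; rewrite le_eqVlt => /predU1P[/esym mE|msm].
  have [c mc [z Hz]] := extend_right_dense Tm t0m mE Dy Hy; exists c, z; split => //.
  have -> // : b = m.
  apply/le_anti; rewrite mb andbT; apply/ler_addgt0Pr => e e0.
  have [s Ts /andP[ms se]] := sigma_dense ubT mE e0.
  exact: ltW (lt_trans (beyond s Ts ms) se).
have [z [Hz _]] := extend_right_scattered Tm t0m msm (interior_subset Dy) Hy.
exists (sigma T m), z; split => //.
by apply: beyond => //; exact: sigma_in.
Qed.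
End Continuation.

(** * The averaging theorem *)

Unset Implicit Arguments.

Theorem theorem2 (R : realType) (n : nat)
  (T Ts : set R) (t0 : R) (dom : bool -> set (R * R))
  (delta : bool -> R -> R -> R) (P p : R)
  (D' D : set 'rV[R]_n) (x0 : 'rV[R]_n) (X : R -> 'rV[R]_n -> 'rV[R]_n)
  (M lambda K ebar r : R) (xi : R -> R -> 'rV[R]_n)
  (hT : time_scale T) (hTub : unbounded_above T)
  (hshift : shift_operators T Ts t0 dom delta)
  (hper : periodic_in_shifts Ts t0 dom)
  (hP : is_shift_period Ts t0 dom P) (hPTs : Ts P) (hPt0 : t0 < P)
  (hpTs : Ts p) (hPp : P <= p)
  (hD'D : D' `<=` D) (hx0 : D' x0)
  (hXper : forall x, D x -> forall j : 'I_n,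
     delta_periodic T Ts dom delta p (fun t => X t x ord0 j))
  (hXrd : forall x, D x -> rd_continuous T T (X ^~ x))
  (hXreg : regressive T D X)
  (hXcauchy : forall eps : R, 0 < eps ->
     cauchy_well_posed T D (fun t x => eps *: X t x))
  (hM : 0 < M) (hXM : forall t x, T t -> D x -> `|X t x| <= M)
  (hlambda : 0 < lambda)
  (hXlip : forall t x1 x2, T t -> D x1 -> D x2 ->
     `|X t x1 - X t x2| <= lambda * `|x1 - x2|)
  (hK : 0 < K)
  (hnode : forall i : nat, (1 <= i)%N ->
     shift_iter delta p t0 i.+1 - shift_iter delta p t0 i <= K)
  (hebar : 0 < ebar) (hr : 0 < r)
  (hxi : forall eps : R, 0 < eps <= ebar ->
     is_piecewise_solution T D (shift_iter delta p t0)
       (fun t x => eps *: partial_average T (shift_iter delta p t0) X t x)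
       x0 (xi eps) /\
     forall t, kappa T t -> t0 <= t -> ball (xi eps t) r `<=` D) :
  forall L : R, 0 < L ->
  exists eps0 C : R, [/\ 0 < eps0, 0 < C &
    forall eps : R, 0 < eps < eps0 ->
      (exists (c : R) (x : R -> 'rV[R]_n), t0 + L * eps^-1 < c /\
         is_solution T D (fun t x => eps *: X t x) t0 x0 (T `&` `[t0, c[) x) /\
      (forall (c : R) (x : R -> 'rV[R]_n),
         is_solution T D (fun t x => eps *: X t x) t0 x0 (T `&` `[t0, c[) x ->
         forall t, T t -> t0 <= t <= t0 + L * eps^-1 -> t < c ->
           `|x t - xi eps t| <= C * eps)].

Proof.
move=> L L0.
have Dx0 : D x0 by exact: hD'D.
(* In dimension [0] the hypothesis on the components of [X] is empty and says
   nothing about the domain of the shifts, but all vectors are equal. *)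
have [n0|npos] := posnP n.
  have eq_all (u v : 'rV[R]_n) : u = v.
    by apply/rowP => -[m mn]; exfalso; rewrite n0 in mn.
  exists 1, 1; split => // eps /andP[eps0 _]; split.
    exists (t0 + L * eps^-1 + 1), (cst x0); split; first by rewrite ltrDl.
    split => // t _; split => //=.
    by rewrite (eq_all (eps *: _) 0); exact: delta_derive_cst.
  move=> c x _ t _ _ _; rewrite (eq_all (x t) (xi eps t)) subrr normr0 mul1r.
  exact: ltW.
have cT : closed T by case: hT.
have t0p : t0 < p := lt_le_trans hPt0 hPp.
have domp b t : Ts t -> dom b (p, t).
  exact: (hXper x0 Dx0 (Ordinal npos) b).1.
pose node := shift_iter delta p t0.
have node_lt i : node i < node i.+1 by exact: (node_ltS hshift hpTs t0p domp).
have Tnode i : T (node i) by exact: (node_inT hshift domp).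
have node_inf t : exists i, t < node i by exact: (node_unbounded cT hshift t0p domp).
(* the bound [K] leaves out the first period, of length [p - t0] *)
pose K' := Num.max K (p - t0).
have gap i : node i.+1 - node i <= K'.
  case: i => [|i]; last by rewrite le_max hnode.
  have [_ pE] := shift_P3r hshift (shift_sub hshift hpTs) (ltW t0p).
  by rewrite le_max /node /= pE lexx orbT.
have K'0 : 0 < K' by rewrite lt_max hK.
pose C := 2 * M * K' + 4 * lambda * M * K' * L * expR (lambda * L).
have C0 : 0 < C by rewrite /C addr_gt0// !mulr_gt0// expR_gt0.
exists (Num.min ebar (r / (2 * C))), C; split => //.
  by rewrite lt_min hebar divr_gt0// mulr_gt0.
move=> eps /andP[eps0]; rewrite lt_min => /andP[epse epsr].
have epsebar : 0 < eps <= ebar by rewrite eps0 ltW.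
have [xi_sol xi_ball] := hxi eps epsebar.
have Ceps : C * eps < r.
  have C2 : 0 < 2 * C by rewrite mulr_gt0.
  move: epsr; rewrite (ltr_pdivlMr _ _ C2) => h.
  have : 0 < C * eps by rewrite mulr_gt0.
  by move: h; lra.
have error y t : T t -> t0 <= t <= t0 + L * eps^-1 ->
    solution_upto T D (fun t x => eps *: X t x) t0 x0 t y -> `|y t - xi eps t| <= C * eps.
  move=> Tt /andP[t0t tL] [ysol yc].
  have tL' : eps * (t - t0) <= L.
    by rewrite mulrC -ler_pdivlMr//; move: tL; lra.
  apply: le_trans (averaging_error cT hTub node_lt Tnode node_inf gap (ltW hM) (ltW hlambda)
    (ltW eps0) hXrd hXM hXlip xi_sol Tt t0t ysol yc) _.
  rewrite -/node /=.
  have e1 : expR (eps * lambda * (t - t0)) <= expR (lambda * L).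
    rewrite ler_expR (_ : eps * lambda * (t - t0) = lambda * (eps * (t - t0))); last by ring.
    by apply: ler_wpM2l => //; exact: ltW.
  have a0 : 0 <= 4 * lambda * M * K' * eps by rewrite !mulr_ge0 ?ltW.
  have e2 : eps * lambda * (4 * M * K' * eps) * (t - t0) <= 4 * lambda * M * K' * eps * L.
    rewrite (_ : eps * lambda * _ * _ =
      4 * lambda * M * K' * eps * (eps * (t - t0))); last by ring.
    exact: ler_wpM2l.
  have -> : C * eps = eps * (2 * M * K') + 4 * lambda * M * K' * eps * L * expR (lambda * L).
    by rewrite /C; ring.
  rewrite lerD2l; apply: ler_pM => //.
  by rewrite mulr_ge0 ?subr_ge0//; apply: ltW; rewrite !mulr_gt0.
split; last first.
  move=> c x xsol t Tt t0tL tc; apply: error => //.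
  by apply: solution_upto_restrict tc xsol => //; case/andP: t0tL.
have GN t x : T t -> D x -> `|eps *: X t x| <= eps * M.
  move=> Tt Dx; rewrite normrZ (gtr0_norm eps0); apply: ler_wpM2l; first exact: ltW.
  exact: hXM.
have Glip t x1 x2 : T t -> D x1 -> D x2 ->
    `|eps *: X t x1 - eps *: X t x2| <= eps * lambda * `|x1 - x2|.
  move=> Tt D1 D2; rewrite -scalerBr normrZ (gtr0_norm eps0) -mulrA.
  by apply: ler_wpM2l; [exact: ltW|exact: hXlip].
have Grd t x : T t -> D x -> right_dense T t ->
    eps *: X s x @[s --> within T (nbhs t)] --> eps *: X t x.
  by move=> Tt Dx td; apply: cvgZr; exact: (hXrd x Dx t Tt).1 td.
have b0 : t0 <= t0 + L * eps^-1.
  by rewrite lerDl mulr_ge0// ltW// invr_gt0.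
apply: (solution_exists cT hTub (shift_sub hshift (shift_t0 hshift)) _ _ GN Glip Grd
  (hXcauchy eps eps0).1 b0).
- by rewrite mulr_ge0 ?ltW.
- by rewrite mulr_ge0 ?ltW.
- move=> t y Tt tb ysol; have near_xi := error y t Tt tb ysol.
  have [t0t _] := andP tb.
  have kt : kappa T t by rewrite kappaE.
  apply/nbhs_ballP; exists (r - C * eps); first by rewrite /= subr_gt0.
  move=> u; rewrite -ball_normE /= => yu; apply: (xi_ball t kt t0t u).
  rewrite -ball_normE /=.
  have -> : xi eps t - u = (xi eps t - y t) + (y t - u) by rewrite addrA subrK.
  apply: le_lt_trans (ler_normD _ _) _; rewrite distrC.
  by move: near_xi yu; lra.
Qed.
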